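(* Let $n\ge m\ge 1$ and consider $\mathbf{y}=\mathbf{H}\mathbf{s}+\mathbf{v}$, where $\mathbf{H}\in\mathbb{R}^{n\times m}$ has i.i.d. Gaussian entries of zero mean and fixed non-zero variance, $\mathbf{v}\sim\mathcal{N}(\mathbf{0},\rho^{-1}\mathbf{I}_n)$, $\mathbf{s}$ is uniformly distributed on $\{\pm1\}^m$, and $\mathbf{H},\mathbf{v},\mathbf{s}$ are mutually independent. Then $$\lim_{\rho\to\infty}\frac{\ln \Pr(\hat{\mathbf{s}}_{\mathrm{SDR}}\neq\mathbf{s})}{\ln\rho}=\lim_{\rho\to\infty}\frac{\ln \Pr(\hat{\mathbf{s}}_{\mathrm{ML}}\neq\mathbf{s})}{\ln\rho}=-\frac n2 .$$
   Context: Let $\mathbf{e}$ denote the all-ones vector. The ML detector is $\hat{\mathbf{s}}_{\mathrm{ML}}\in\arg\min_{\hat{\mathbf{s}}\in\{\pm1\}^m}\|\mathbf{y}-\mathbf{H}\hat{\mathbf{s}}\|^2$ (ties broken by any fixed rule). The SDR detector: let $$\mathbf{L}=\begin{bmatrix}\mathbf{H}^T\mathbf{H}&-\mathbf{H}^T\mathbf{y}\\-\mathbf{y}^T\mathbf{H}&\mathbf{y}^T\mathbf{y}\end{bmatrix}\in\mathbb{S}^{m+1},$$ and let $\mathbf{X}^\star$ be an optimal point (chosen by any fixed rule, so that it is a function of $(\mathbf{H},\mathbf{y})$) of the semidefinite program $\min_{\mathbf{X}}\mathrm{Tr}(\mathbf{L}\mathbf{X})$ subject to $\mathrm{diag}(\mathbf{X})=\mathbf{e}$,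 $\mathbf{X}\succeq\mathbf{0}$ ($\mathbf{X}$ symmetric positive semidefinite of size $(m+1)\times(m+1)$). Then $[\hat{\mathbf{s}}_{\mathrm{SDR}}]_i=\mathrm{sgn}([\mathbf{X}^\star]_{i,m+1})$, $i=1,\dots,m$, where $\mathrm{sgn}(x)=1$ for $x>0$ and $\mathrm{sgn}(x)=-1$ for $x\le 0$. *)

(* Defs.v *)
From HB Require Import structures.
From mathcomp Require Import all_boot all_order all_algebra.
From mathcomp Require Import all_classical all_reals all_analysis.
Set Implicit Arguments.
Unset Strict Implicit.
Unset Printing Implicit Defensive.
Import Order.TTheory GRing.Theory Num.Theory.
Import numFieldNormedType.Exports.
Local Open Scope classical_set_scope.
Local Open Scope ring_scope.

Section Detectors.
Variable R : realType.
Variables n m : nat.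

Definition pm1vec (t : 'cV[R]_m) : Prop := forall i, t i 0 = 1 \/ t i 0 = -1.

Definition sqnorm k (z : 'cV[R]_k) : R := \sum_(i < k) z i 0 ^+ 2.

Definition is_ML_point (H : 'M[R]_(n, m)) (y : 'cV[R]_n) (sh : 'cV[R]_m) : Prop :=
  pm1vec sh /\
  forall t, pm1vec t -> sqnorm (y - H *m sh) <= sqnorm (y - H *m t).

Definition Lmat (H : 'M[R]_(n, m)) (y : 'cV[R]_n) : 'M[R]_(m + 1) :=
  block_mx (H^T *m H) (- (H^T *m y)) (- (y^T *m H)) (y^T *m y).

Definition psd k (X : 'M[R]_k) : Prop :=
  X^T = X /\ forall z : 'cV[R]_k, 0 <= (z^T *m X *m z) 0 0.

Definition sdp_feasible (X : 'M[R]_(m + 1)) : Prop :=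
  (forall i, X i i = 1) /\ psd X.

Definition is_SDR_opt (H : 'M[R]_(n, m)) (y : 'cV[R]_n) (X : 'M[R]_(m + 1)) : Prop :=
  sdp_feasible X /\
  forall X', sdp_feasible X' -> \tr (Lmat H y *m X) <= \tr (Lmat H y *m X').

Definition sgn (x : R) : R := if 0 < x then 1 else -1.

Definition sdr_decision (X : 'M[R]_(m + 1)) : 'cV[R]_m :=
  \col_(i < m) sgn (X (lshift 1 i) (rshift m ord0)).

End Detectors.

Section Model.
Context {d : measure_display} {T : measurableType d} {R : realType}.
Variable P : probability T R.
Variables n m : nat.

(* Joint law of (H, v, s): H has i.i.d. N(0, sigma^2) entries,
   v ~ N(0, vsd^2 I_n) (i.e. i.i.d. N(0, vsd^2) entries),
   s uniform on {+-1}^m, and H, v, s mutually independent.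
   Stated as: on every measurable rectangle the joint probability is the product. *)
Definition model_law (sigma vsd : R)
    (H : T -> 'M[R]_(n, m)) (v : T -> 'cV[R]_n) (s : T -> 'cV[R]_m) : Prop :=
  (forall i j, measurable_fun setT (fun x => H x i j)) /\
  (forall i, measurable_fun setT (fun x => v x i 0)) /\
  (forall t, measurable [set x | s x = t]) /\
  forall (A : 'I_n -> 'I_m -> set R) (B : 'I_n -> set R) (t : 'cV[R]_m),
    (forall i j, measurable (A i j)) -> (forall i, measurable (B i)) ->
    P ([set x | (forall i j, H x i j \in A i j) /\ (forall i, v x i 0 \in B i)
                /\ s x = t])
    = ((\prod_(i < n) \prod_(j < m) normal_prob 0 sigma (A i j))
       * (\prod_(i < n) normal_prob 0 vsd (B i))
       * (if `[< pm1vec t >] then (2 ^- m)%:E else 0))%E.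

End Model.

(* Main.v *)
(** Write [X] for the optimal point. If a detector errs, some feasible [X] with
    [\tr (L X) <= |v|^2] has [s_i X_{i,m+1} <= 0]; the maximum likelihood point is
    the rank-one case. As a Gram matrix of unit vectors [p_0, p_1, ..., p_m] (with
    [p_0] for the last index and the sign [s_j] absorbed in [p_j] and [h_j]), it
    gives [|\sum_j h_j (p_j - p_0)| <= 2 |v|] with [p_i] in the half space opposite
    to [p_0], where [h_j] is the [j]th column of [H]. Projecting along
    [p_i - p_0] onto the orthogonal complement of [p_0], and then applying a
    pivoted Gram-Schmidt process, one gets a lower triangular matrix [b] with
    [|\sum_j h_j b_jk| = O(|v|)] for all [k]; since the [p_j] lie on a sphere, all
    its rows lie on one quadric, which has only [m - 1] unknown coefficients [c_k].
    Discretise everything at scale [1/N ~ rho^(-1/2)], the coefficient [c_k] only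
    at scale [1/A_k], where [A_k / N] bounds column [k] of [b]. There are [A_k]
    choices for each [c_k] and, because the quadric is nonsingular, about
    [\prod_k A_k] choices for each of the [m - 1] remaining rows of [b], whereas
    the triangular constraints leave a proportion [N^(-n) \prod_k A_k^(-n)] of the
    grid cells for [H]. As [m <= n], the powers of [A_k] cancel, and the cells that
    [H] must meet have total probability [N^(-n)] up to a power of [ln rho].

    Conversely, both detectors fail when [s] is the all-ones vector, the first column
    of [H] is close to [rho^(-1/2) e_1], the other columns are close to [e_j], and
    [v] is close to [-2 rho^(-1/2) e_1]; this has probability of order
    [rho^(-n/2)]. *)

Require Import Defs.
From HB Require Import structures.
From mathcomp Require Import all_boot all_order all_algebra all_fingroup.
From mathcomp Require Import ring lra.
Import Order.TTheory GRing.Theory Num.Theory.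
Local Open Scope ring_scope.

(** * Pivoted Gram-Schmidt for a semi-inner product *)

Section SemiInnerProduct.
Context {R : rcfType} {V : lmodType R} (B : V -> V -> R).
Context (BC : forall x y, B x y = B y x).
Context (BD : forall x y z, B (x + y) z = B x z + B y z).
Context (BZ : forall c x z, B (c *: x) z = c * B x z).
Context (B_ge0 : forall x, 0 <= B x x).

Lemma sipN x z : B (- x) z = - B x z.
Proof. by rewrite -scaleN1r BZ mulN1r. Qed.

Lemma sipB x y z : B (x - y) z = B x z - B y z.
Proof. by rewrite BD sipN. Qed.

Lemma sipDr x y z : B z (x + y) = B z x + B z y.
Proof. by rewrite ![B z _]BC BD. Qed.

Lemma sipZr c x z : B z (c *: x) = c * B z x.
Proof. by rewrite ![B z _]BC BZ. Qed.

Lemma sipBr x y z : B z (x - y) = B z x - B z y.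
Proof. by rewrite ![B z _]BC sipB. Qed.

Lemma sip0 z : B 0 z = 0.
Proof. by rewrite -(scale0r 0) BZ mul0r. Qed.

Lemma sip_sum I (r : seq I) (Q : pred I) (F : I -> V) z :
  B (\sum_(i <- r | Q i) F i) z = \sum_(i <- r | Q i) B (F i) z.
Proof.
by elim/big_rec2: _ => [|i u v _ <-]; rewrite ?sip0 ?BD.
Qed.

Lemma sip_CauchySchwarz x y : B x y ^+ 2 <= B x x * B y y.
Proof.
have [y0|yN0] := eqVneq (B y y) 0.
  have [->|xyN0] := eqVneq (B x y) 0; first by rewrite expr0n/= mulr_ge0.
  (* With [B y y = 0] the square of [x - t *: y] is [B x x - 2 t B x y], which this [t] makes equal
     to [-1]. *)
  pose t := (B x x + 1) / (2 * B x y).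
  have := B_ge0 (x - t *: y).
  rewrite sipB !sipBr !BZ !sipZr y0 !(BC y x) mulr0 mulr0 subr0.
  have -> : t * B x y = (B x x + 1) / 2 by rewrite /t; field.
  by move=> h; exfalso; lra.
have y_gt0 : 0 < B y y by rewrite lt_neqAle eq_sym yN0 B_ge0.
have := B_ge0 (B y y *: x - B x y *: y).
rewrite sipB !sipBr !BZ !sipZr (BC y x) => h.
rewrite -subr_ge0 -(pmulr_rge0 _ y_gt0); lra.
Qed.

Lemma sip_norm_le x y a b : 0 <= a -> 0 <= b -> B x x <= a ^+ 2 ->
  B y y <= b ^+ 2 -> `|B x y| <= a * b.
Proof.
move=> a0 b0 xa yb; rewrite -(@ler_pXn2r _ 2)// ?nnegrE ?normr_ge0 ?mulr_ge0//.
rewrite real_normK ?num_real// exprMn.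
by apply: le_trans (sip_CauchySchwarz x y) _; exact: ler_pM.
Qed.

Lemma pivoted_gram_schmidt N (a : 'I_N -> V) :
  exists (p : 'S_N) (q : 'I_N -> V),
  [/\ forall k, B (q k) (q k) <= 1,
      forall x, (forall j, B (a j) x = 0) -> forall k, B (q k) x = 0,
      forall j k : 'I_N, (j < k)%N -> B (a (p j)) (q k) = 0,
      forall j k, `|B (a j) (q k)| <= B (a (p k)) (q k) &
      forall j x, B (a j) x = \sum_k B (a j) (q k) * B (q k) x].
Proof.
elim: N a => [|N IH] a.
  by exists 1%g, (fun=> 0); split; try (by case); move=> x _ [].
have B0r z : B z 0 = 0 by rewrite BC sip0.
case: (@arg_maxP _ _ _ ord0 xpredT (fun i => B (a i) (a i))) => // j0 _ maxj0.
(* If even the largest norm vanishes, every [a j] pairs to zero with everything, and zero directions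
   will do. *)
have [z0|nz0] := eqVneq (B (a j0) (a j0)) 0.
  have a0 j x : B (a j) x = 0.
    have aj : B (a j) (a j) = 0.
      by apply/eqP; rewrite eq_le B_ge0 andbT -z0; exact: maxj0.
    apply/eqP; rewrite -sqrf_eq0 eq_le sqr_ge0 andbT.
    by have := sip_CauchySchwarz (a j) x; rewrite aj mul0r.
  exists 1%g, (fun=> 0); split=> [k|x _ k|j k _|j k|j x]; rewrite ?a0 ?sip0//.
    by rewrite normr0.
  by rewrite big1// => k _; rewrite ?a0 ?mul0r ?mulr0.
have p0 : 0 < B (a j0) (a j0) by rewrite lt_neqAle eq_sym nz0 B_ge0.
pose r := Num.sqrt (B (a j0) (a j0)).
have r0 : 0 < r by rewrite sqrtr_gt0.
have rr : r ^+ 2 = B (a j0) (a j0) by rewrite sqr_sqrtr// ltW.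
pose q0 := r^-1 *: a j0.
have q0q0 : B q0 q0 = 1 by rewrite BZ sipZr -rr; field; rewrite gt_eqF.
have aj0 x : B (a j0) x = r * B q0 x by rewrite BZ mulrA mulfV ?mul1r// gt_eqF.
pose a' j := a (lift j0 j) - B (a (lift j0 j)) q0 *: q0.
have a'E j x : B (a (lift j0 j)) x = B (a' j) x + B (a (lift j0 j)) q0 * B q0 x.
  by rewrite sipB BZ subrK.
have [p [q [q1 qs qt qm qe]]] := IH a'.
have a'q0 j : B (a' j) q0 = 0 by rewrite sipB BZ q0q0 mulr1 subrr.
have qq0 k : B (q k) q0 = 0 by exact: qs.
pose q' k := if unlift ord0 k is Some k' then q k' else q0.
have q'0 : q' ord0 = q0 by rewrite /q' unlift_none.
have q'l k : q' (lift ord0 k) = q k by rewrite /q' liftK.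
have aql j k : B (a (lift j0 j)) (q k) = B (a' j) (q k).
  by rewrite a'E (BC q0) qq0 mulr0 addr0.
have aq0 k : B (a j0) (q k) = 0 by rewrite aj0 BC qq0 mulr0.
have aj0q0 : B (a j0) q0 = r by rewrite aj0 q0q0 mulr1.
exists (lift_perm ord0 j0 p), q'; split.
- by move=> k; case: (unliftP ord0 k) => [k'|] ->; rewrite ?q'0 ?q'l ?q0q0.
- move=> x ax k; have q0x : B q0 x = 0 by rewrite BZ ax mulr0.
  case: (unliftP ord0 k) => [k'|] ->; rewrite ?q'0 ?q'l ?q0x//.
  by apply: qs => j; rewrite sipB BZ ax q0x mulr0 subr0.
- move=> j k; case: (unliftP ord0 k) => [k'|] ->; last by rewrite ltn0.
  rewrite q'l; case: (unliftP ord0 j) => [j'|] ->; last by rewrite lift_perm_id aq0.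
  by rewrite lift_perm_lift aql !lift0 ltnS; exact: qt.
- move=> j k; case: (unliftP ord0 k) => [k'|] ->; rewrite ?q'0 ?q'l.
    rewrite lift_perm_lift aql; case: (unliftP j0 j) => [j'|] ->.
      by rewrite aql.
    by rewrite aq0 normr0; apply: le_trans (normr_ge0 _) (qm (p k') k').
  rewrite lift_perm_id aj0q0 -[r]mulr1; apply: sip_norm_le; [exact: ltW | by [] | |].
    by rewrite rr; exact: maxj0.
  by rewrite q0q0 expr1n.
- move=> j x; rewrite big_ord_recl q'0.
  under eq_bigr do rewrite q'l.
  case: (unliftP j0 j) => [j'|] ->.
    rewrite a'E addrC; congr (_ + _); rewrite qe.
    by apply: eq_bigr => k _; rewrite aql.
  rewrite aj0q0 aj0 big1 ?addr0// => k _; by rewrite aq0 mul0r.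
Qed.

(* With [w_j = p_j - p_0], row [j] of [b] starts with [B w_j p_0 / B w_i0 p_0] and
   goes on with the pivoted coordinates of the component of [w_j] orthogonal to
   [p_0] along [w_i0], rescaled to make the equation of the sphere the one below.
   The permutation [s] puts [i0] first. *)
Lemma unit_vectors_triangular m (p0 : V) (p : 'I_m.+1 -> V) (i0 : 'I_m.+1) :
  B p0 p0 = 1 -> (forall j, B (p j) (p j) = 1) -> B (p i0) p0 <= 0 ->
  exists (s : 'S_m.+1) (b : 'I_m.+1 -> 'I_m.+1 -> R) (c : 'I_m -> R),
  [/\ [/\ forall k, `|c k| <= 2, forall j, 0 <= b j ord0 <= 2,
        forall j k, `|b j (lift ord0 k)| <= b (lift ord0 k) (lift ord0 k) &
        forall j k, `|b j (lift ord0 k)| <= 6],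
      forall k, b ord0 k = (k == ord0)%:R,
      forall j k : 'I_m.+1, (j < k)%N -> b j k = 0,
      forall j, b j ord0 ^+ 2 - b j ord0
          + b j ord0 * (\sum_k c k * b j (lift ord0 k))
          + \sum_k b j (lift ord0 k) ^+ 2 = 0 /\
        (\sum_k c k * b j (lift ord0 k)) ^+ 2
          <= 4 * \sum_k b j (lift ord0 k) ^+ 2 &
      forall (h : 'I_m.+1 -> R) e, 0 <= e ->
        B (\sum_j h j *: (p j - p0)) (\sum_j h j *: (p j - p0)) <= e ^+ 2 ->
        forall k, `|\sum_j h (s j) * b j k| <= 3 * e].
Proof.
move=> p00 pp pi0.
pose d j := 1 - B (p j) p0.
have [w wE] : exists w : 'I_m.+1 -> V, forall j, w j = p j - p0.
  by exists (fun j => p j - p0).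
have ler1 : 0 <= 1 :> R by [].
have Bp j : `|B (p j) p0| <= 1.
  by rewrite -[1]mulr1; apply: sip_norm_le; rewrite ?pp ?p00 ?expr1n.
have d02 j : 0 <= d j <= 2 by have := Bp j; rewrite ler_norml /d; lra.
have wp0 j : B (w j) p0 = - d j by rewrite wE sipB p00 /d; ring.
(* As [p j] and [p0] lie on the unit sphere, the squared length of [w j] is linear in [w j]; this
   becomes the quadric. *)
have ww j : B (w j) (w j) = 2 * d j.
  by rewrite wE sipB !sipBr p00 pp (BC p0) /d; ring.
have di1 : 1 <= d i0 by rewrite /d; lra.
have di0 : 0 < d i0 by lra.
(* The inverse length of [w i0]; it is at most [1] because [p i0] lies opposite to [p0]. *)
pose l := Num.sqrt ((2 * d i0)^-1).
have l0 : 0 < l by rewrite sqrtr_gt0 invr_gt0; lra.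
have ll : l ^+ 2 * (2 * d i0) = 1.
  by rewrite sqr_sqrtr ?mulVf//; [lra|rewrite invr_ge0; lra].
have l1 : 2 * l ^+ 2 <= 1.
  have l20 := sqr_ge0 l.
  have : 0 <= (l ^+ 2) * (d i0 - 1) by apply: mulr_ge0 => //; lra.
  lra.
have lle : l <= 1.
  rewrite -(@ler_pXn2r _ 2)// ?nnegrE ?(ltW l0)// expr1n.
  have := sqr_ge0 l; lra.
pose e j := 2 * l ^+ 2 * d j.
have e02 j : 0 <= e j <= 2.
  have := d02 j; have := sqr_ge0 l; rewrite /e => h0 /andP[h1 h2].
  rewrite mulr_ge0//=; last lra.
  by apply: le_trans h2; rewrite ler_piMl.
have ei0 : e i0 = 1 by rewrite -[RHS]ll /e; ring.
have ed j : e j * d i0 = d j by rewrite -[RHS]mulr1 -[X in _ = _ * X]ll /e; ring.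
(* As [e j = d j / d i0], the vector [a j] is orthogonal to [p0]; this projection along [w i0] kills
   [w i0] itself. *)
pose a j := l *: (w j - e j *: w i0).
have ai0 x : B (a i0) x = 0 by rewrite /a ei0 scale1r subrr BZ sip0 mulr0.
have Bww j k : `|B (w j) (w k)| <= 2 * 2.
  by apply: sip_norm_le; rewrite ?ww//; have := d02 j; have := d02 k; lra.
have aa j : B (a j) (a j) =
   l ^+ 2 * (2 * d j - 2 * e j * B (w j) (w i0) + e j ^+ 2 * (2 * d i0)).
  by rewrite /a !BZ !sipZr !sipB !sipBr !BZ !sipZr !ww (BC (w i0)); ring.
have aa_le j : B (a j) (a j) <= 6 ^+ 2.
  rewrite aa.
  have Q : 2 * d j - 2 * e j * B (w j) (w i0) + e j ^+ 2 * (2 * d i0) <= 36.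
    have h1 := d02 j; have h2 := d02 i0; have h3 := e02 j.
    have h4 := Bww j i0; move: h4; rewrite ler_norml => h4.
    have h5 : - (e j * B (w j) (w i0)) <= 2 * 4.
      rewrite -mulrN.
      apply: (@le_trans _ _ (e j * 4)); first by rewrite ler_wpM2l//; lra.
      by lra.
    have h6 : e j ^+ 2 * (2 * d i0) <= 4 * 4.
      have : e j ^+ 2 <= 2 ^+ 2 by apply: lerXn2r; rewrite ?nnegrE; lra.
      by move=> h; apply: ler_pM; rewrite ?sqr_ge0//; lra.
    by lra.
  have l20 := sqr_ge0 l.
  apply: (@le_trans _ _ (l ^+ 2 * 36)); first exact: ler_wpM2l.
  lra.
have [s' [q [q1 qs qt qm qe]]] := pivoted_gram_schmidt _ (fun j => a (lift i0 j)).
pose s := lift_perm ord0 i0 s'.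
pose b0 j k := if unlift ord0 k is Some k' then B (a j) (q k') else e j.
have b00 j : b0 j ord0 = e j by rewrite /b0 unlift_none.
have b0l j k : b0 j (lift ord0 k) = B (a j) (q k) by rewrite /b0 liftK.
have qe' j x : B (a j) x = \sum_k B (a j) (q k) * B (q k) x.
  case: (unliftP i0 j) => [j'|] ->; first exact: qe.
  by rewrite ai0 big1// => k _; rewrite ai0 mul0r.
(* These are the coordinates of a vector of length [2], hence the bound on [c] and the second
   inequality for the rows. *)
pose c k := B (q k) ((2 * l) *: w i0).
have cb j : \sum_k c k * b0 j (lift ord0 k) = B (a j) ((2 * l) *: w i0).
  by rewrite qe'; apply: eq_bigr => k _; rewrite b0l mulrC.
have bb j : \sum_k b0 j (lift ord0 k) ^+ 2 = B (a j) (a j).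
  by rewrite [RHS]qe'; apply: eq_bigr => k _; rewrite b0l expr2 (BC (q k)).
have cc : B ((2 * l) *: w i0) ((2 * l) *: w i0) = 2 ^+ 2.
  by rewrite BZ sipZr ww -[RHS]mulr1 -[X in _ = _ * X]ll; ring.
exists s, (fun j => b0 (s j)), c; split.
- split.
  + move=> k; rewrite /c -[leRHS]mul1r; apply: sip_norm_le => //.
      by rewrite expr1n.
    by rewrite cc.
  + by move=> j; rewrite b00.
  + move=> j k; rewrite !b0l lift_perm_lift.
    case: (unliftP i0 (s j)) => [j'|] ->; first exact: qm.
    by rewrite ai0 normr0; apply: le_trans (normr_ge0 _) (qm (s' k) k).
  + move=> j k; rewrite b0l -[leRHS]mulr1; apply: sip_norm_le => //.
    by rewrite expr1n.
- move=> k; rewrite lift_perm_id.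
  case: (unliftP ord0 k) => [k'|] ->; rewrite ?b00 ?b0l ?ei0 ?eqxx ?ai0//.
- move=> j k; case: (unliftP ord0 k) => [k'|] ->; last by rewrite ltn0.
  rewrite b0l; case: (unliftP ord0 j) => [j'|] ->; last by rewrite lift_perm_id ai0.
  by rewrite lift_perm_lift !lift0 ltnS; exact: qt.
(* Substitute [w_j = e_j w_i0 + a_j / l] in [B w_j w_j = - 2 B w_j p_0] and multiply by [l ^ 2]. *)
- move=> j; rewrite !cb !bb !b00; split.
    have -> : B (a (s j)) ((2 * l) *: w i0) =
        2 * l ^+ 2 * B (w (s j)) (w i0) - 2 * e (s j) * (l ^+ 2 * (2 * d i0)).
      by rewrite /a sipZr BZ sipB BZ ww; ring.
    have -> : B (a (s j)) (a (s j)) = e (s j)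
         - 2 * e (s j) * (l ^+ 2 * B (w (s j)) (w i0))
         + e (s j) ^+ 2 * (l ^+ 2 * (2 * d i0)).
      by rewrite aa /e; ring.
    by rewrite ll; ring.
  apply: le_trans (sip_CauchySchwarz _ _) _; rewrite cc.
  by rewrite le_eqVlt; apply/orP; left; apply/eqP; ring.
- move=> h r r0 Bx k; set x := \sum_j _ in Bx.
  have xE : x = \sum_j h j *: w j by apply: eq_bigr => j _; rewrite wE.
  (* The first column gives the component of [x] along [p0] times [- 2 l ^ 2], of absolute value at
     most [1]; in the other columns the two terms of [a j] contribute [1] and [2] to the factor
     [3]. *)
  pose t := \sum_j h j * e j.
  have -> : \sum_j h (s j) * b0 (s j) k = \sum_j h j * b0 j k.
    by rewrite [RHS](reindex_inj (@perm_inj _ s)).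
  have tE : t = - (2 * l ^+ 2) * B x p0.
    rewrite xE sip_sum mulr_sumr; apply: eq_bigr => j _.
    by rewrite BZ wp0 /e; ring.
  have t_le : `|t| <= r.
    rewrite tE normrM normrN (ger0_norm (mulr_ge0 _ (sqr_ge0 _)))//.
    rewrite -[leRHS]mul1r; apply: ler_pM => //.
      by rewrite mulr_ge0 ?sqr_ge0.
    by rewrite -[leRHS]mulr1; apply: sip_norm_le => //; rewrite p00 expr1n.
  case: (unliftP ord0 k) => [k'|] ->; last first.
    by under eq_bigr do rewrite b00; rewrite -/t; lra.
  under eq_bigr do rewrite b0l.
  have -> : \sum_j h j * B (a j) (q k') = l * (B x (q k') - t * B (w i0) (q k')).
    rewrite xE sip_sum mulr_suml -sumrB mulr_sumr; apply: eq_bigr => j _.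
    by rewrite /a !BZ sipB BZ; ring.
  rewrite normrM (ger0_norm (ltW l0)) -[leRHS]mul1r; apply: ler_pM => //.
    exact: ltW.
  have xq : `|B x (q k')| <= r * 1 by apply: sip_norm_le => //; rewrite expr1n.
  have wq : `|B (w i0) (q k')| <= 2 * 1.
    by apply: sip_norm_le => //; rewrite ?expr1n// ww; have := d02 i0; lra.
  apply: le_trans (ler_normB _ _) _; rewrite normrM.
  have : `|t| * `|B (w i0) (q k')| <= r * 2 by rewrite ler_pM//; lra.
  lra.
Qed.
End SemiInnerProduct.

(* On the quadric, [x0] is the pairing of the point with the gradient (Euler), so
   the gradient could only be small near the origin, where its first component is
   close to [-1]. *)
Lemma quadric_gradient (R : realFieldType) m (x0 : R) (x c : 'I_m -> R) :
  let d := (6000 * m.+1%:R)^-1 in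
  0 <= x0 <= 2 -> (forall k, `|c k| <= 2) -> (forall k, `|x k| <= 6) ->
  x0 ^+ 2 - x0 + x0 * (\sum_k c k * x k) + \sum_k x k ^+ 2 = 0 ->
  (\sum_k c k * x k) ^+ 2 <= 4 * \sum_k x k ^+ 2 ->
  d <= `|2 * x0 - 1 + \sum_k c k * x k| \/
  exists k, d <= `|x k| /\ d <= `|2 * x k + x0 * c k|.
Proof.
move=> d /andP[x00 x02] c2 x6; set b := \sum_k _; set g := \sum_k _ => F0 bg.
have m1 : 1 <= m.+1%:R :> R by rewrite ler1n.
have d0 : 0 < d by rewrite invr_gt0 mulr_gt0 ?ltr0n.
have dm : d * m.+1%:R = 6000^-1 by rewrite /d; field; lra.
have d1 : d <= 6000^-1.
  by rewrite -dm -[leLHS]mulr1; apply: ler_wpM2l => //; exact: ltW.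
have [|Fs] := leP d `|2 * x0 - 1 + b|; [by left|right].
have F2 : `|2 * x0 - 1 + b| < 2^-1 by apply: lt_le_trans Fs _; clear -d1; lra.
have gE : g = x0 * (1 - x0 - b) by rewrite -[RHS]addr0 -F0; ring.
(* On the quadric, the squared first derivative is the discriminant of the equation in [x0]. For [g]
   below [1 / 64] the bound on [b] makes it at least [1 / 2], against [F2]. *)
have FE : (2 * x0 - 1 + b) ^+ 2 = (1 - b) ^+ 2 - 4 * g.
  by rewrite gE; ring.
have g_ge : 64^-1 <= g.
  rewrite leNgt; apply/negP => g_lt.
  have b4 : `|b| < 4^-1.
    rewrite -(@ltr_pXn2r _ 2)// ?nnegrE ?normr_ge0 ?invr_ge0//.
    rewrite real_normK ?num_real// expr2.
    by move: bg g_lt; rewrite expr2; clear; lra.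
  have b3 : (3 / 4) ^+ 2 <= (1 - b) ^+ 2.
    move: b4; rewrite ltr_norml; clear => b4.
    by rewrite ler_pXn2r ?nnegrE//; lra.
  have : (2 * x0 - 1 + b) ^+ 2 <= (2^-1) ^+ 2.
    rewrite -real_normK ?num_real//.
    by rewrite ler_pXn2r ?nnegrE ?normr_ge0 ?invr_ge0// ltW.
  by rewrite FE; move: b3 g_lt; rewrite !expr2; clear; lra.
move: F2; rewrite ltr_norml => F2.
have x0_ge : 160^-1 <= x0.
  have : x0 * (1 - x0 - b) <= x0 * (5 / 2).
    by apply: ler_wpM2l => //; move: F2 x02; clear; lra.
  by rewrite -gE; move: g_ge; clear; lra.
(* Euler's identity; the factor [1 - (2 * x0 - 1 + b)] is at least [1 / 2]. *)
have sumE : \sum_k x k * (2 * x k + x0 * c k) = x0 * (1 - (2 * x0 - 1 + b)).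
  transitivity (2 * g + x0 * b).
    by rewrite /g /b !mulr_sumr -big_split/=; apply: eq_bigr => k _; ring.
  by rewrite gE; ring.
have sum_ge : 320^-1 <= \sum_k x k * (2 * x k + x0 * c k).
  rewrite sumE; apply: (@le_trans _ _ (x0 * 2^-1)).
    by move: x0_ge; clear; lra.
  by apply: ler_wpM2l => //; move: F2; clear; lra.
(* Pigeonhole: [16 d m] is at most [16 / 6000], below [1 / 320]. The two factors of the chosen term
   are at most [6] and [16], so each is at least [d]. *)
have [k xFk] : exists k, 16 * d <= x k * (2 * x k + x0 * c k).
  apply/existsP; apply: contraT; rewrite negb_exists => /forallP h.
  have hs : \sum_k x k * (2 * x k + x0 * c k) <= (16 * d) * m%:R.
    rewrite mulr_natr -[m in leRHS]card_ord -sumr_const.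
    by apply: ler_sum => k _; rewrite ltW// ltNge h.
  have : (16 * d) * m%:R <= 16 * (d * m.+1%:R).
    by rewrite -mulrA; apply: ler_wpM2l => //; apply: ler_wpM2l; [exact: ltW|rewrite ler_nat].
  by rewrite dm; move: sum_ge hs; clear; lra.
exists k; have ck := c2 k; have xk := x6 k.
have gk : `|2 * x k + x0 * c k| <= 16.
  apply: le_trans (ler_normD _ _) _; rewrite !normrM.
  rewrite (ger0_norm x00) (@ger0_norm _ 2)//.
  have : x0 * `|c k| <= 2 * 2 by apply: ler_pM.
  by move: xk; clear; lra.
have := le_trans xFk (ler_norm _); rewrite normrM => h; split.
  have : `|x k| * `|2 * x k + x0 * c k| <= `|x k| * 16 by exact: ler_wpM2l.
  by move: h; clear; lra.
have : `|x k| * `|2 * x k + x0 * c k| <= 6 * `|2 * x k + x0 * c k| by exact: ler_wpM2r.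
by move: h d0; clear; lra.
Qed.

(** * Counting grid points *)

Lemma card_cover (R : numDomainType) (I U : finType) (S : {set U}) (Q : {set I})
    (W : I -> {set U}) (c : R) :
  (forall x, x \in S -> exists2 i, i \in Q & x \in W i) ->
  (forall i, i \in Q -> #|W i|%:R <= c) -> #|S|%:R <= c * #|Q|%:R.
Proof.
move=> SW Wc; have : (#|S| <= \sum_(i in Q) #|W i|)%N.
  apply: (@leq_trans (\sum_(i in Q) \sum_(x in S) (x \in W i))).
    rewrite exchange_big/= -sum1_card; apply: leq_sum => x /SW[i iQ xi].
    by rewrite (bigD1 i)//= xi.
  apply: leq_sum => i _; rewrite -big_mkcondr/= sum1_card.
  by apply: subset_leq_card; apply/subsetP => x /andP[].
rewrite -(ler_nat R) => /le_trans; apply.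
rewrite natr_sum mulr_natr -sumr_const; exact: ler_sum.
Qed.

Lemma card_fiber (R : numDomainType) (T U : finType) (S : {set T}) (g : T -> U)
    (W : {set U}) (c : R) :
  (forall x, x \in S -> g x \in W) ->
  (forall u, u \in W -> #|[set x in S | g x == u]|%:R <= c) ->
  #|S|%:R <= c * #|W|%:R.
Proof.
move=> SW Wc; apply: (@card_cover _ _ _ _ W (fun u => [set x in S | g x == u])) => //.
by move=> x xS; exists (g x); rewrite ?SW// inE xS eqxx.
Qed.

Lemma card_ffun_box (I T : finType) (S : {set {ffun I -> T}}) (W : I -> {set T}) :
  (forall f, f \in S -> forall i, f i \in W i) -> (#|S| <= \prod_i #|W i|)%N.
Proof.
move=> SW; have -> : (\prod_i #|W i|)%N = #|family W|.
  by rewrite card_family foldrE big_map enumT.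
apply: subset_leq_card; apply/subsetP => f fS.
by apply/familyP => i; apply: SW.
Qed.

Definition ffun_set (I : finType) (T : Type) (k : I) (f : {ffun I -> T}) (a : T) :
  {ffun I -> T} := [ffun i => if i == k then a else f i].

(** Resetting coordinate [k] to a fixed value sends [S] into the box of the other coordinates, with
    fibres on lines in direction [k]. *)
Lemma card_ffun_drop (R : numDomainType) (I T : finType) (S : {set {ffun I -> T}})
    (W : I -> {set T}) (k : I) (c : R) : 0 <= c ->
  (forall f, f \in S -> forall i, f i \in W i) ->
  (forall f, #|[set a | ffun_set _ _ k f a \in S]|%:R <= c) ->
  #|S|%:R <= c * \prod_(i | i != k) #|W i|%:R.
Proof.
move=> c0 SW Sc; have [->|[f0 f0S]] := set_0Vmem S.
  by rewrite cards0 mulr_ge0 ?prodr_ge0.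
pose g f := ffun_set _ _ k f (f0 k).
have gS : #|g @: S|%:R <= \prod_(i | i != k) #|W i|%:R :> R.
  rewrite -natr_prod ler_nat.
  have -> : (\prod_(i | i != k) #|W i|
     = \prod_i #|if i == k then [set f0 k] else W i|)%N.
    rewrite [RHS](bigD1 k)//= eqxx cards1 mul1n.
    by apply: eq_bigr => i /negPf ->.
  apply: card_ffun_box => _ /imsetP[f fS ->] i; rewrite ffunE.
  by case: ifP => [/eqP _|_]; rewrite ?set11 ?SW.
apply: (@le_trans _ _ (c * #|g @: S|%:R)); last exact: ler_wpM2l.
apply: (@card_fiber _ _ _ _ g) => [f fS|_ /imsetP[f fS ->]]; first exact: imset_f.
apply: le_trans (Sc f); rewrite ler_nat.
rewrite -(@card_in_imset _ _ (fun h : {ffun I -> T} => h k)) => [|h1 h2]; last first.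
  rewrite !inE => /andP[_ /eqP h1E] /andP[_ /eqP h2E] h12.
  apply/ffunP => i; have [->//|ik] := eqVneq i k.
  have := congr1 (fun h : {ffun I -> T} => h i) (etrans h1E (esym h2E)).
  by rewrite !ffunE (negPf ik).
apply: subset_leq_card; apply/subsetP => _ /imsetP[h + ->]; rewrite !inE.
move=> /andP[hS /eqP hE].
suff -> : ffun_set _ _ k f (h k) = h by [].
apply/ffunP => i; rewrite ffunE; have [->//|ik] := eqVneq i k.
have := congr1 (fun h : {ffun I -> T} => h i) hE.
by rewrite !ffunE (negPf ik).
Qed.

(** Back substitution: coordinates are chosen from the last to the first, so the induction splits
    off coordinate [0], which depends on all the others. *)
Lemma card_ffun_triangular (R : realDomainType) (T : finType) m
    (S : {set {ffun 'I_m -> T}}) (D : 'I_m -> R) :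
  (forall k, 0 <= D k) ->
  (forall (k : 'I_m) (f : {ffun 'I_m -> T}),
    #|[set a | [exists g in S, [forall j : 'I_m, (k < j)%N ==> (g j == f j)] && (g k == a)]]|%:R
     <= D k) ->
  #|S|%:R <= \prod_k D k.
Proof.
elim: m S D => [|m IH] S D D0 SD.
  rewrite big_ord0 -[1]/(1%:R) ler_nat.
  apply: leq_trans (max_card _) _.
  by rewrite card_ffun card_ord expn0.
pose g (f : {ffun 'I_m.+1 -> T}) := [ffun j => f (lift ord0 j)].
rewrite big_ord_recl.
have gS : #|g @: S|%:R <= \prod_k D (lift ord0 k).
  apply: IH => [k|k f] //.
  have [->|[h0 h0S]] := set_0Vmem S.
    rewrite (_ : [set _ | _] = set0) ?cards0//.
    apply/setP => a; rewrite !inE; apply/existsP => -[h].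
    by rewrite imset0 inE.
  pose f' : {ffun 'I_m.+1 -> T} :=
    [ffun j => if unlift ord0 j is Some j' then f j' else h0 ord0].
  apply: le_trans (SD (lift ord0 k) f'); rewrite ler_nat.
  apply: subset_leq_card; apply/subsetP => a; rewrite !inE.
  move=> /existsP[g0 /andP[/imsetP[h hS ->{g0}] /andP[/forallP hf /eqP <-]]].
  apply/existsP; exists h; rewrite hS ffunE eqxx andbT.
  apply/forallP => j; apply/implyP; case: (unliftP ord0 j) => [j'|] -> //.
  rewrite !lift0 ltnS => kj; rewrite ffunE liftK.
  by have := hf j'; rewrite kj ffunE.
apply: (@le_trans _ _ (D ord0 * #|g @: S|%:R)); last exact: ler_wpM2l.
apply: (@card_fiber _ _ _ _ g) => [f fS|_ /imsetP[f fS ->]]; first exact: imset_f.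
apply: le_trans (SD ord0 f); rewrite ler_nat.
rewrite -(@card_in_imset _ _ (fun h : {ffun 'I_m.+1 -> T} => h ord0)) => [|h1 h2]; last first.
  rewrite !inE => /andP[_ /eqP h1E] /andP[_ /eqP h2E] h12.
  apply/ffunP => i; case: (unliftP ord0 i) => [j|] -> //.
  have := congr1 (fun h : {ffun 'I_m -> T} => h j) (etrans h1E (esym h2E)).
  by rewrite !ffunE.
apply: subset_leq_card; apply/subsetP => _ /imsetP[h + ->]; rewrite !inE.
move=> /andP[hS /eqP hE]; apply/existsP; exists h; rewrite hS eqxx andbT.
apply/forallP => i; case: (unliftP ord0 i) => [j|] -> //.
have := congr1 (fun h : {ffun 'I_m -> T} => h j) hE.
by rewrite !ffunE => ->; rewrite eqxx implybT.
Qed.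

(** * Grid points in intervals and near parabolas *)

Lemma card_ord_leq K (A : {set 'I_K}) B :
  (forall a, a \in A -> (a <= B)%N) -> (#|A| <= B.+1)%N.
Proof.
move=> AB; rewrite -[B.+1](size_iota 0) cardE -(size_map (@nat_of_ord K)).
apply: uniq_leq_size; first by rewrite map_inj_uniq ?enum_uniq//; exact: val_inj.
by move=> _ /mapP[a + ->]; rewrite mem_enum mem_iota => /AB.
Qed.

(** Reals in [[-M, M]] are rounded down to multiples of [1 / N], named by natural numbers so that
    rounded configurations form a finite type. *)
Definition gridpt {R : numFieldType} (N M a : nat) : R := a%:R / N%:R - M%:R.

Lemma gridpt_approx {R : archiRealFieldType} (N M : nat) (x : R) : (0 < N)%N ->
  - M%:R <= x <= M%:R ->
  exists2 a : nat, (a <= 2 * M * N)%N &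
    gridpt N M a <= x <= gridpt N M a + N%:R^-1.
Proof.
move=> N0 /andP[x1 x2].
have NR : 0 < N%:R :> R by rewrite ltr0n.
have y0 : 0 <= N%:R * (x + M%:R) by rewrite mulr_ge0 ?ler0n//; lra.
exists (Num.truncn (N%:R * (x + M%:R))).
  rewrite -(ler_nat R); apply: le_trans (_ : N%:R * (x + M%:R) <= _).
    by rewrite truncn_le.
  rewrite !natrM mulrC ler_wpM2r ?ler0n//; lra.
have /andP[a1 a2] := truncn_itv y0; rewrite /gridpt; move: a1 a2.
set a := Num.truncn _ => a1 a2.
rewrite lerBlDr ler_pdivrMr// mulrC a1/=.
suff : x + M%:R <= a%:R / N%:R + N%:R^-1 by lra.
rewrite -[X in _ <= _ + X]mul1r -mulrDl ler_pdivlMr// mulrC natr1.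
exact: ltW.
Qed.

Lemma card_grid_ball {R : archiRealFieldType} K (N M : nat) (A : {set 'I_K}) (r : R) :
  (0 < N)%N -> 0 <= r ->
  {in A &, forall a b : 'I_K, gridpt N M a - gridpt N M b <= r} ->
  #|A|%:R <= r * N%:R + 1.
Proof.
move=> N0 r0 Ar; have NR : 0 < N%:R :> R by rewrite ltr0n.
have rN : 0 <= r * N%:R by rewrite mulr_ge0// ltW.
have [->|[a aA]] := set_0Vmem A; first by rewrite cards0; lra.
case: (arg_minnP (@nat_of_ord K) aA) => b bA bmin.
pose d := Num.truncn (r * N%:R).
have : (#|A| <= d.+1)%N.
  rewrite -[d.+1](size_iota b) cardE -(size_map (@nat_of_ord K)).
  apply: uniq_leq_size; first by rewrite map_inj_uniq ?enum_uniq//; exact: val_inj.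
  move=> _ /mapP[c + ->]; rewrite mem_enum => cA.
  rewrite mem_iota bmin//= addnS ltnS -leq_subLR /d truncn_ge_nat//.
  have := Ar c b cA bA; rewrite /gridpt natrB ?bmin//.
  have -> : c%:R / N%:R - M%:R - (b%:R / N%:R - M%:R) = (c%:R - b%:R) / N%:R :> R.
    by ring.
  by rewrite ler_pdivrMr.
rewrite -(ler_nat R) => /le_trans; apply; rewrite -natr1 lerD2r.
by rewrite /d truncn_le.
Qed.

Lemma card_grid_affine {R : archiRealFieldType} K (N M : nat) (A : {set 'I_K}) (u v t : R) :
  (0 < N)%N -> u != 0 -> 0 <= t ->
  {in A, forall a : 'I_K, `|gridpt N M a * u + v| <= t} ->
  #|A|%:R <= 2 * t / `|u| * N%:R + 1.
Proof.
move=> N0 u0 t0 At; have nu : 0 < `|u| by rewrite normr_gt0.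
apply: (@card_grid_ball _ _ _ M) => //; first by rewrite divr_ge0 ?mulr_ge0.
move=> a b /At aA /At bA; apply: le_trans (ler_norm _) _.
rewrite ler_pdivlMr// -normrM mulrBl.
have -> : gridpt N M a * u - gridpt N M b * u =
  (gridpt N M a * u + v) - (gridpt N M b * u + v) by ring.
by apply: le_trans (ler_normB _ _) _; lra.
Qed.

(** The difference of two values is [(x - y) (x + y + u)]. Among points where the derivative has one
    sign this bounds [x - y]; the two signs give the factor [2]. *)
Lemma card_grid_quadratic {R : archiRealFieldType} K (N M : nat) (A : {set 'I_K})
    (u v t d : R) :
  (0 < N)%N -> 0 < d -> 0 <= t ->
  {in A, forall a : 'I_K, let x := gridpt N M a in
    `|x ^+ 2 + u * x + v| <= t /\ d <= `|2 * x + u|} ->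
  #|A|%:R <= 2 * (2 * t / d * N%:R + 1).
Proof.
move=> N0 d0 t0 At.
have td : 0 <= 2 * t / d by rewrite divr_ge0 ?mulr_ge0// ltW.
pose A1 := [set a in A | d <= 2 * gridpt N M a + u].
have sub x y : `|x ^+ 2 + u * x + v| <= t -> `|y ^+ 2 + u * y + v| <= t ->
    2 * d <= (2 * x + u) + (2 * y + u) -> x - y <= 2 * t / d.
  move=> xt yt dxy; rewrite ler_pdivlMr//.
  have [xy|xy] := leP x y.
    by apply: (@le_trans _ _ 0); [apply: mulr_le0_ge0; lra|lra].
  have h : (x - y) * (2 * d) <= (x - y) * ((2 * x + u) + (2 * y + u)).
    by apply: ler_wpM2l => //; lra.
  have e : (x - y) * ((2 * x + u) + (2 * y + u)) =
    2 * ((x ^+ 2 + u * x + v) - (y ^+ 2 + u * y + v)) by ring.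
  move: xt yt h; rewrite e !ler_norml; clear; lra.
have h1 : #|A1|%:R <= 2 * t / d * N%:R + 1.
  apply: (@card_grid_ball _ _ _ M) => // a b.
  rewrite !inE => /andP[/At[a1 _] a2] /andP[/At[b1 _] b2].
  by apply: sub => //; move: a2 b2; clear; lra.
have h2 : #|A :\: A1|%:R <= 2 * t / d * N%:R + 1.
  apply: (@card_grid_ball _ _ _ M) => // a b.
  rewrite !inE => /andP[a3 aA] /andP[b3 bA].
  have [a1 a2] := At _ aA; have [b1 b2] := At _ bA.
  move: a3 b3; rewrite aA bA/= -!ltNge => a3 b3.
  have a4 : 2 * gridpt N M a + u <= - d.
    by move: a2 a3; clear -d0; case: ler0P => _; lra.
  have b4 : 2 * gridpt N M b + u <= - d.
    by move: b2 b3; clear -d0; case: ler0P => _; lra.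
  move: a1 b1 a4 b4; set x := gridpt N M a; set y := gridpt N M b.
  move=> xt yt x4 y4.
  have [xy|xy] := leP x y; first by apply: le_trans td; lra.
  rewrite ler_pdivlMr//.
  have h : (x - y) * ((2 * x + u) + (2 * y + u)) <= (x - y) * (- (2 * d)).
    by apply: ler_wpM2l; lra.
  have e : (x - y) * ((2 * x + u) + (2 * y + u)) =
    2 * ((x ^+ 2 + u * x + v) - (y ^+ 2 + u * y + v)) by ring.
  by move: xt yt h; rewrite e !ler_norml; clear; lra.
have : (#|A| <= #|A1| + #|A :\: A1|)%N.
  rewrite -(cardsID A1 A) leq_add2r; apply: subset_leq_card; exact: subsetIr.
rewrite -(ler_nat R) natrD; lra.
Qed.

(** * Bad grid cells *)

(** The equation of the unit sphere in the coordinates of [unit_vectors_triangular]. *)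
Definition quadric {R : pzRingType} {m} (c : 'I_m -> R) (x : 'I_m.+1 -> R) : R :=
  x ord0 ^+ 2 - x ord0 + x ord0 * (\sum_k c k * x (lift ord0 k))
  + \sum_k x (lift ord0 k) ^+ 2.

(** The partial derivatives of [quadric]. *)
Definition dquadric {R : pzRingType} {m} (c : 'I_m -> R) (x : 'I_m.+1 -> R)
    (k : 'I_m.+1) : R :=
  if unlift ord0 k is Some k' then 2 * x k + x ord0 * c k'
  else 2 * x ord0 - 1 + \sum_k c k * x (lift ord0 k).

(** Every square has coefficient [1], so freezing the other coordinates leaves a monic quadratic
    polynomial, as [card_grid_quadratic] requires. *)
Lemma quadric_coord {R : comPzRingType} {m} (c : 'I_m -> R) x k :
  exists u v, forall y, (forall j, j != k -> y j = x j) ->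
    quadric c y = y k ^+ 2 + u * y k + v /\ dquadric c y k = 2 * y k + u.
Proof.
rewrite /quadric /dquadric; case: (unliftP ord0 k) => [k'|] ->.
  exists (x ord0 * c k'), (x ord0 ^+ 2 - x ord0
      + x ord0 * (\sum_(i | i != k') c i * x (lift ord0 i))
      + \sum_(i | i != k') x (lift ord0 i) ^+ 2) => y yx.
  rewrite yx ?neq_lift//; split=> //.
  have e1 : \sum_(i | i != k') c i * y (lift ord0 i)
      = \sum_(i | i != k') c i * x (lift ord0 i).
    by apply: eq_bigr => i ik; rewrite yx ?(inj_eq lift_inj).
  have e2 : \sum_(i | i != k') y (lift ord0 i) ^+ 2
      = \sum_(i | i != k') x (lift ord0 i) ^+ 2.
    by apply: eq_bigr => i ik; rewrite yx ?(inj_eq lift_inj).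
  by rewrite (bigD1 k')//= [\sum_k y _ ^+ 2](bigD1 k')//= e1 e2; ring.
exists (\sum_k c k * x (lift ord0 k) - 1), (\sum_k x (lift ord0 k) ^+ 2) => y yx.
have -> : \sum_k c k * y (lift ord0 k) = \sum_k c k * x (lift ord0 k).
  by apply: eq_bigr => i _; rewrite yx.
have -> : \sum_k y (lift ord0 k) ^+ 2 = \sum_k x (lift ord0 k) ^+ 2.
  by apply: eq_bigr => i _; rewrite yx.
by split; ring.
Qed.

Section BadCells.
Context {R : archiRealFieldType} (n m N L : nat).
Context (N_gt0 : (0 < N)%N) (L_gt0 : (0 < L)%N).

(** One index type serves three grids: channel entries in [[-L, L]] and matrix entries in [[-7, 7]],
    at resolution [1 / N], and coefficients in [[-2, 2]], at resolution [2 ^- L] at the finest. *)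
Definition cellN := (2 * L * N + 14 * N + 4 * 2 ^ L).+1.
Local Notation cell := 'I_cellN.
Local Notation row := {ffun 'I_m.+1 -> cell}.

(* [scale b k] bounds column [k] of the triangular matrix in units of [1 / N]; the
   first column has entries of order [1]. *)
Definition scale (b : {ffun 'I_m -> 'I_L.+1}) (k : 'I_m.+1) : nat :=
  if unlift ord0 k is Some k' then 2 ^ b k' else N.

(* The constant of [quadric_gradient]. *)
Definition gap : R := (6000 * m.+1%:R)^-1.
(** The slacks absorb rounding: [42] comes from [quadric_close]; in [slackH], [6 * n] bounds the
    exact combination of columns and [8] the rounding of each term. *)
Definition slackF : R := 42 * m.+1%:R.
Definition slackH : R := 6 * n%:R + 8 * m.+1%:R.

(* The resolution [1 / scale] suffices for the coefficient of a variable which is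
   itself at most [scale / N]. *)
Definition coeff b (c : {ffun 'I_m -> cell}) (k : 'I_m) : R :=
  gridpt (scale b (lift ord0 k)) 2 (c k).
Definition entry (x : row) (k : 'I_m.+1) : R := gridpt N 7 (x k).

(** What rounding leaves of lying on the quadric. The last clause provides a steep coordinate whose
    scale is comparable to [N]; solving for it saves a full factor [N]. *)
Definition near_quadric b c (x : row) : bool :=
  [&& [forall k, `|entry x k| <= 3 * ((scale b k)%:R / N%:R)],
      `|quadric (coeff b c) (entry x)| <= slackF / N%:R &
      [exists k, (gap * N%:R <= (scale b k)%:R)
              && (gap / 2 <= `|dquadric (coeff b c) (entry x) k|)]].

(** The first row is known exactly, so only [m] rows are discretised. *)
Definition tri (l : {ffun 'I_m -> row}) (j k : 'I_m.+1) : R :=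
  if unlift ord0 j is Some j' then entry (l j') k else (k == ord0)%:R.

Definition near_kernel l (x : row) : bool :=
  [forall j, (x j <= 2 * L * N)%N] &&
  [forall k : 'I_m.+1, `|\sum_(j : 'I_m.+1 | (k <= j)%N) gridpt N L (x j) * tri l j k|
     <= slackH * L%:R / N%:R].

(* A column of scale at most [2] may have a vanishing pivot; it is then not used to
   restrict the cells of the channel matrix. *)
Definition pivots (b : {ffun 'I_m -> 'I_L.+1}) l : bool :=
  [forall k : 'I_m, (2 ^ b k <= 2)%N ||
   ((2 ^ b k)%:R / (4 * N%:R) <= `|tri l (lift ord0 k) (lift ord0 k)|)].

(** Here [b] encodes the column scales, [c] the coefficients of the quadric, [l] the unknown rows of
    the triangular matrix, and [f] the cells of the channel entries. Fixing them in this order makes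
    the count a product. *)
Definition bad_cells : {set {ffun 'I_n -> row}} :=
  [set f : {ffun 'I_n -> row} |
   [exists b in [set b : {ffun 'I_m -> 'I_L.+1} | [forall k : 'I_m, (2 ^ b k <= 14 * N)%N]],
    [exists c in [set c : {ffun 'I_m -> cell} | [forall k : 'I_m, (c k <= 4 * 2 ^ b k)%N]],
    [exists l in [set l : {ffun 'I_m -> row} |
        pivots b l && [forall j : 'I_m, near_quadric b c (l j)]],
     [forall r : 'I_n, near_kernel l (f r)]]]]].

Let NR : 0 < N%:R :> R. Proof. by rewrite ltr0n. Qed.
Let N1 : 1 <= N%:R :> R. Proof. by rewrite ler1n. Qed.
Let L1 : 1 <= L%:R :> R. Proof. by rewrite ler1n. Qed.
Let gap_gt0 : 0 < gap. Proof. by rewrite invr_gt0 mulr_gt0 ?ltr0n. Qed.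
Let scale_gt0 b k : (0 < scale b k)%N.
Proof. by rewrite /scale; case: unlift => [k'|]; rewrite ?expn_gt0. Qed.
Let scale_ge1 b k : 1 <= (scale b k)%:R :> R. Proof. by rewrite ler1n. Qed.
Let slackF_ge0 : 0 <= slackF. Proof. by rewrite mulr_ge0. Qed.
Let slackH_ge1 : 1 <= slackH.
Proof.
have : 0 <= n%:R :> R by []. have : 1 <= m.+1%:R :> R by rewrite ler1n.
by rewrite /slackH; lra.
Qed.

Definition row_const : R := 2 * (4 * slackF / gap + 1) * 7 ^+ m / gap * m.+1%:R.

Lemma row_const_ge0 : 0 <= row_const.
Proof.
rewrite /row_const !mulr_ge0 ?exprn_ge0 ?invr_ge0 ?addr_ge0 ?divr_ge0 ?mulr_ge0//; exact: ltW.
Qed.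

(** Choose a steep coordinate [k]. Every other coordinate [i] has at most [7 * scale b i] values,
    after which the quadric leaves boundedly many for coordinate [k]. *)
Lemma card_near_quadric b c :
  #|[set x | near_quadric b c x]|%:R
    <= row_const * \prod_k (scale b (lift ord0 k))%:R.
Proof.
pose Q := [set k | gap * N%:R <= (scale b k)%:R].
pose W k := [set x | [&& [forall k, `|entry x k| <= 3 * ((scale b k)%:R / N%:R)],
      `|quadric (coeff b c) (entry x)| <= slackF / N%:R &
      gap / 2 <= `|dquadric (coeff b c) (entry x) k| ] ].
pose P : R := \prod_k (scale b (lift ord0 k))%:R.
have P0 : 0 <= P by apply: prodr_ge0.
pose C : R := 2 * (4 * slackF / gap + 1).
have C0 : 0 <= C.
  by rewrite /C mulr_ge0// addr_ge0// divr_ge0 ?mulr_ge0// ltW.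
pose box k : {set cell} := [set a : cell | `|gridpt N 7 a : R| <= 3 * ((scale b k)%:R / N%:R) ].
have box_le k : #|box k|%:R <= 7 * (scale b k)%:R :> R.
  have h0 : 0 <= 3 * ((scale b k)%:R / N%:R) :> R.
    by rewrite mulr_ge0// divr_ge0.
  have := @card_grid_affine R _ N 7 (box k) 1 0 (3 * ((scale b k)%:R / N%:R))
     N_gt0 (oner_neq0 _) h0.
  rewrite normr1 divr1 => /(_ _)/le_trans; apply.
    by move=> a; rewrite inE mulr1 addr0.
  have -> : 2 * (3 * ((scale b k)%:R / N%:R)) * N%:R = 6 * (scale b k)%:R :> R.
    by field; rewrite gt_eqF.
  have := scale_ge1 b k; lra.
have Wk k : k \in Q -> #|W k|%:R <= C * (7 ^+ m / gap * P).
  rewrite inE => kQ.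
  have Sk : (0 : R) < (scale b k)%:R by rewrite ltr0n.
  have : #|W k|%:R <= C * \prod_(i | i != k) #|box i|%:R.
    apply: (@card_ffun_drop _ _ _ _ _ k) => //.
      by move=> f; rewrite inE => /andP[/forallP h _] i; rewrite inE; exact: h.
    move=> f; have [u [v uv]] := quadric_coord (coeff b c) (entry f) k.
    have g0 : 0 < gap / 2 by rewrite divr_gt0.
    have t0 : 0 <= slackF / N%:R by rewrite divr_ge0// ltW.
    have := @card_grid_quadratic R _ N 7
      [set a : cell | ffun_set 'I_m.+1 cell k f a \in W k] u v _ _ N_gt0 g0 t0.
    move=> /(_ _)/le_trans; apply; last first.
      rewrite le_eqVlt; apply/orP; left; apply/eqP; rewrite /C; field.
      by rewrite !gt_eqF.
    move=> a; rewrite !inE => /and3P[_ h1 h2].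
    have [|e1 e2] := uv (entry (ffun_set 'I_m.+1 cell k f a)).
      by move=> j /negPf jk; rewrite /entry ffunE jk.
    move: h1 h2; rewrite e1 e2.
    have -> : entry (ffun_set 'I_m.+1 cell k f a) k = gridpt N 7 a.
      by rewrite /entry ffunE eqxx.
    by move=> h1 h2; split.
  move=> /le_trans; apply; apply: ler_wpM2l => //.
  apply: (@le_trans _ _ (\prod_(i | i != k) (7 * (scale b i)%:R))).
    by apply: ler_prod => i _; rewrite ler0n box_le.
  rewrite big_split/= prodr_const.
  have -> : #|[pred i : 'I_m.+1 | i != k]| = m.
    by transitivity #|predC1 k|; [exact: eq_card|rewrite cardC1 card_ord].
  rewrite -mulrA; apply: ler_wpM2l; first exact: exprn_ge0.
  (* The first column has scale [N], so omitting column [k] instead leaves [N P / scale b k], at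
     most [P / gap]. *)
  have PE : N%:R * P = (scale b k)%:R * \prod_(i | i != k) (scale b i)%:R.
    transitivity (\prod_i (scale b i)%:R : R); last by rewrite (bigD1 k).
    by rewrite big_ord_recl; congr (_ * _); rewrite /scale unlift_none.
  rewrite -(ler_pM2l Sk) -PE mulrA; apply: ler_wpM2r => //.
  by rewrite ler_pdivlMr// mulrC.
apply: (@le_trans _ _ (C * (7 ^+ m / gap * P) * #|Q|%:R)).
  apply: card_cover Wk => x; rewrite inE => /and3P[h1 h2 /existsP[k /andP[h3 h4]]].
  by exists k; rewrite inE ?h1 ?h2.
have QR : #|Q|%:R <= m.+1%:R :> R.
  by rewrite ler_nat; apply: leq_trans (max_card _) _; rewrite card_ord.
apply: (@le_trans _ _ (C * (7 ^+ m / gap * P) * m.+1%:R)).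
  apply: ler_wpM2l; last exact: QR.
  by apply: mulr_ge0 => //; apply: mulr_ge0 => //; rewrite divr_ge0 ?exprn_ge0// ltW.
rewrite /row_const -/C -/P le_eqVlt; apply/orP; left; apply/eqP; ring.
Qed.


(** By triangularity, constraint [k] confines entry [k], given the later ones, to an interval of
    length inversely proportional to the pivot. For scales at most [2] the trivial bound on the
    number of grid points is already good enough. *)
Lemma card_near_kernel b l : pivots b l -> (forall k, (2 ^ b k <= 14 * N)%N) ->
  #|[set x | near_kernel l x]|%:R
    <= \prod_k ((8 * slackH + 14) * L%:R * N%:R / (scale b k)%:R).
Proof.
move=> /forallP piv b14.
have sH : 0 <= slackH by apply: le_trans slackH_ge1.
have LR : 0 < L%:R :> R by rewrite ltr0n.
apply: card_ffun_triangular => [k|k f].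
  by rewrite !mulr_ge0 ?invr_ge0//; move: slackH_ge1; lra.
set A := [set a | _].
have AP (a : cell) : a \in A -> (a <= 2 * L * N)%N /\
   `|gridpt N L a * tri l k k
     + \sum_(j : 'I_m.+1 | (k < j)%N) gridpt N L (f j) * tri l j k|
     <= slackH * L%:R / N%:R.
  rewrite inE => /existsP[g]; rewrite inE.
  move=> /andP[/andP[/forallP g1 /forallP g2] /andP[/forallP gf /eqP <-]].
  split; first exact: g1.
  apply: le_trans (g2 k); rewrite le_eqVlt; apply/orP; left; apply/eqP.
  rewrite [in RHS](bigD1 k)//=; congr (`|_ + _|).
  apply: eq_big => [j|j kj]; first by rewrite ltn_neqAle eq_sym andbC.
  by have := gf j; rewrite kj => /eqP ->.
have triv : #|A|%:R <= 3 * L%:R * N%:R :> R.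
  apply: (@le_trans _ _ ((2 * L * N).+1%:R)); last first.
    rewrite -natr1 !natrM.
    have : 1 <= L%:R * N%:R :> R by rewrite -natrM ler1n muln_gt0 L_gt0.
    by lra.
  by rewrite ler_nat; apply: card_ord_leq => a /AP[].
have aff u : u != 0 -> `|tri l k k| = u ->
    #|A|%:R <= 2 * (slackH * L%:R / N%:R) / u * N%:R + 1.
  move=> + tE; rewrite -tE => u0; apply: (@card_grid_affine _ _ _ L) => //.
  - by rewrite -normr_eq0.
  - by rewrite divr_ge0 ?mulr_ge0// ltW.
  - by move=> a /AP[_]; apply.
have D_ge : #|A|%:R <= (8 * slackH + 14) * L%:R * N%:R / (scale b k)%:R.
  have sk : 0 < (scale b k)%:R :> R by rewrite ltr0n.
  have LN : 0 <= L%:R * N%:R :> R by rewrite mulr_ge0.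
  rewrite ler_pdivlMr//.
  case: (unliftP ord0 k) => [k'|] kE; last first.
    have -> : (scale b k)%:R = N%:R :> R by rewrite /scale kE unlift_none.
    have t1 : `|tri l k k| = 1 by rewrite /tri kE unlift_none eqxx normr1.
    apply: ler_wpM2r; first exact: ler0n.
    apply: le_trans (aff _ (oner_neq0 _) t1) _.
    have -> : 2 * (slackH * L%:R / N%:R) / 1 * N%:R = 2 * slackH * L%:R.
      by field; rewrite gt_eqF.
    have : slackH * L%:R >= 0 by rewrite mulr_ge0.
    by move: L1; lra.
  have sE : scale b k = (2 ^ b k')%N by rewrite /scale kE liftK.
  have s14 : (scale b k)%:R <= 14 * N%:R :> R by rewrite sE -natrM ler_nat.
  have [s2|/negPf s2] := boolP (scale b k <= 2)%N.
    have : #|A|%:R * (scale b k)%:R <= 3 * L%:R * N%:R * 2 :> R.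
      by apply: ler_pM => //; rewrite ler_nat.
    have : 0 <= slackH * (L%:R * N%:R) by rewrite mulr_ge0.
    by move: LN; lra.
  have := piv k'; rewrite -sE s2/= -kE => pk.
  have t0 : 0 < `|tri l k k|.
    by apply: lt_le_trans pk; rewrite divr_gt0// mulr_gt0.
  have := aff _ (lt0r_neq0 t0) erefl => h.
  apply: (@le_trans _ _ ((2 * (slackH * L%:R / N%:R)
       / ((scale b k)%:R / (4 * N%:R)) * N%:R + 1) * (scale b k)%:R)).
    apply: ler_wpM2r; first exact: ler0n.
    apply: le_trans h _; rewrite lerD2r; apply: ler_wpM2r; first exact: ler0n.
    apply: ler_wpM2l; first by rewrite mulr_ge0// divr_ge0 ?mulr_ge0// ltW.
    by rewrite lef_pV2// posrE// divr_gt0// mulr_gt0.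
  have -> : (2 * (slackH * L%:R / N%:R)
       / ((scale b k)%:R / (4 * N%:R)) * N%:R + 1) * (scale b k)%:R
     = 8 * slackH * L%:R * N%:R + (scale b k)%:R.
    by field; rewrite !gt_eqF.
  have : N%:R * 1 <= N%:R * L%:R :> R by apply: ler_wpM2l.
  by move: s14; lra.
exact: D_ge.
Qed.

(** The factors come from the scales, the coefficients, the triangular rows and the channel rows, in
    this order. *)
Definition bad_const : R :=
  2 ^+ m * 5 ^+ m * row_const ^+ m * (8 * slackH + 14) ^+ (m.+1 * n).

(** For fixed scales with product [P] there are, up to constants and powers of [L], [P] choices of
    coefficients, [P ^ m] of triangular rows and [N ^ (m n) / P ^ n] of channel cells. *)
Lemma card_bad_cells : (m.+1 <= n)%N ->
  #|bad_cells|%:R <= bad_const * L%:R ^+ (m + m.+1 * n) * N%:R ^+ (m * n).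
Proof.
move=> mn.
have LR : 0 < L%:R :> R by rewrite ltr0n.
pose S : R := 8 * slackH + 14.
have S0 : 0 <= S by rewrite /S; move: slackH_ge1; lra.
have RC := row_const_ge0.
pose X : R := 5 ^+ m * row_const ^+ m * (S * L%:R) ^+ (m.+1 * n) * N%:R ^+ (m * n).
have X0 : 0 <= X.
  apply: mulr_ge0; [apply: mulr_ge0; [apply: mulr_ge0|]|]; apply: exprn_ge0 => //.
  exact: mulr_ge0.
apply: (@le_trans _ _ (X * #|{: {ffun 'I_m -> 'I_L.+1}}|%:R)); last first.
  rewrite card_ffun !card_ord natrX.
  apply: (@le_trans _ _ (X * (2 * L%:R) ^+ m)).
    apply: ler_wpM2l => //; apply: lerXn2r; rewrite ?nnegrE ?mulr_ge0//.
    by rewrite -natr1; move: L1; lra.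
  rewrite le_eqVlt; apply/orP; left; apply/eqP.
  by rewrite /X /bad_const -/S !exprMn exprD; ring.
rewrite -[#|{: {ffun 'I_m -> 'I_L.+1}}|]cardsT.
pose Wb (b : {ffun 'I_m -> 'I_L.+1}) := [set f in bad_cells |
    [forall k, (2 ^ b k <= 14 * N)%N] &&
    [exists c in [set c : {ffun 'I_m -> cell} | [forall k : 'I_m, (c k <= 4 * 2 ^ b k)%N]],
    [exists l in [set l : {ffun 'I_m -> row} |
        pivots b l && [forall j : 'I_m, near_quadric b c (l j)]],
     [forall r : 'I_n, near_kernel l (f r)]]]].
have := @card_cover R _ _ bad_cells setT Wb X; apply.
  move=> f fB; move: (fB); rewrite inE => /existsP[b /andP[b1 b2]].
  by exists b; rewrite !inE//; rewrite inE in fB; rewrite fB b2; rewrite inE in b1; rewrite b1.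
move=> b _.
have [/forallP b14|b14] := boolP [forall k, (2 ^ b k <= 14 * N)%N]; last first.
  rewrite (_ : Wb b = set0) ?cards0//.
  by apply/setP => f; rewrite /Wb !inE (negPf b14) andbF.
pose P : R := \prod_k (scale b (lift ord0 k))%:R.
have P1 : 1 <= P.
  rewrite /P; elim/big_ind: _ => // x y x1 y1.
  by rewrite -[1]mulr1; apply: ler_pM.
have P0 : 0 < P by lra.
pose Y : R := (S * L%:R) ^+ (m.+1 * n) * N%:R ^+ (m * n) / P ^+ n.
have Y0 : 0 <= Y.
  apply: divr_ge0; last by rewrite exprn_ge0// ltW.
  by apply: mulr_ge0; apply: exprn_ge0 => //; apply: mulr_ge0.
have YE : (\prod_k ((8 * slackH + 14) * L%:R * N%:R / (scale b k)%:R)) ^+ n = Y.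
  have -> : \prod_k ((8 * slackH + 14) * L%:R * N%:R / (scale b k)%:R)
      = (S * L%:R) ^+ m.+1 * N%:R ^+ m / P.
    rewrite -/S big_split/= prodr_const card_ord prodfV big_ord_recl -/P.
    have -> : scale b ord0 = N by rewrite /scale unlift_none.
    rewrite exprMn [N%:R ^+ m.+1]exprSr; field.
    by rewrite !gt_eqF.
  by rewrite /Y !exprMn exprVn -!exprM.
have step l : pivots b l ->
   #|[set f : {ffun 'I_n -> row} | [forall r, near_kernel l (f r)]]|%:R <= Y.
  move=> pl; rewrite -YE.
  apply: (@le_trans _ _ ((#|[set x | near_kernel l x]| ^ n)%:R)).
    rewrite ler_nat; apply: leq_trans (card_ffun_box _ _ _ (fun=> [set x | near_kernel l x]) _) _.
      by move=> f; rewrite inE => /forallP h i; rewrite inE.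
    by rewrite prod_nat_const card_ord.
  rewrite natrX; apply: lerXn2r; rewrite ?nnegrE//; last exact: card_near_kernel.
  by apply: prodr_ge0 => k _; rewrite divr_ge0 ?mulr_ge0.
have step2 c : #|[set f : {ffun 'I_n -> row} |
    [exists l in [set l : {ffun 'I_m -> row} |
        pivots b l && [forall j : 'I_m, near_quadric b c (l j)]],
     [forall r : 'I_n, near_kernel l (f r)]]]|%:R <= Y * (row_const * P) ^+ m.
  apply: (@le_trans _ _ (Y * #|[set l : {ffun 'I_m -> row} |
        pivots b l && [forall j : 'I_m, near_quadric b c (l j)]]|%:R)).
    apply: (@card_cover _ _ _ _ _
       (fun l => [set f : {ffun 'I_n -> row} | [forall r : 'I_n, near_kernel l (f r)]])).
      by move=> f; rewrite inE => /existsP[l /andP[l1 l2]]; exists l; rewrite ?inE// inE in l1 *.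
    by move=> l; rewrite inE => /andP[pl _]; exact: step.
  apply: ler_wpM2l => //.
  apply: (@le_trans _ _ ((#|[set x | near_quadric b c x]| ^ m)%:R)).
    rewrite ler_nat; apply: leq_trans (card_ffun_box _ _ _ (fun=> [set x | near_quadric b c x]) _) _.
      by move=> f; rewrite inE => /andP[_ /forallP h] i; rewrite inE.
    by rewrite prod_nat_const card_ord.
  rewrite natrX; apply: lerXn2r; rewrite ?nnegrE//; last exact: card_near_quadric.
  by rewrite mulr_ge0// ltW.
(* The total power of [P] is [m + 1 - n]; this is where the hypothesis that there are no more
   columns than rows enters. *)
apply: (@le_trans _ _ (Y * (row_const * P) ^+ m * (5 ^+ m * P))); last first.
  rewrite /Y /X [(row_const * P) ^+ m]exprMn.
  have -> : (S * L%:R) ^+ (m.+1 * n) * N%:R ^+ (m * n) / P ^+ n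
       * (row_const ^+ m * P ^+ m) * (5 ^+ m * P) =
     (5 ^+ m * row_const ^+ m * (S * L%:R) ^+ (m.+1 * n) * N%:R ^+ (m * n))
     * (P ^+ m.+1 / P ^+ n) by rewrite [P ^+ m.+1]exprS; ring.
  rewrite -[leRHS]mulr1; apply: ler_wpM2l; first exact: X0.
  by rewrite ler_pdivrMr ?exprn_gt0// mul1r; apply: ler_weXn2l.
apply: (@le_trans _ _ (Y * (row_const * P) ^+ m *
   #|[set c : {ffun 'I_m -> cell} | [forall k : 'I_m, (c k <= 4 * 2 ^ b k)%N]]|%:R)).
  apply: card_cover (fun c _ => step2 c) => f; rewrite !inE => /and3P[_ _].
  by move=> /existsP[c /andP[c1 c2]]; exists c => //; rewrite inE.
apply: ler_wpM2l.
  by rewrite mulr_ge0// exprn_ge0// mulr_ge0// ltW.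
apply: (@le_trans _ _ ((\prod_(k < m) #|[set a : cell | (a <= 4 * 2 ^ b k)%N]|)%:R)).
  rewrite ler_nat; apply: card_ffun_box => f; rewrite inE => /forallP h i.
  by rewrite inE.
have -> : 5 ^+ m * P = \prod_(k < m) (5 * (scale b (lift ord0 k))%:R).
  by rewrite big_split/= prodr_const card_ord.
rewrite natr_prod; apply: ler_prod => k _; rewrite ler0n/=.
have -> : scale b (lift ord0 k) = (2 ^ b k)%N by rewrite /scale liftK.
rewrite -natrM ler_nat; apply: (@leq_trans (4 * 2 ^ b k).+1).
  by apply: card_ord_leq => a; rewrite inE.
by rewrite -[5%N]/(4 + 1)%N mulnDl mul1n -addn1 leq_add2l expn_gt0.
Qed.
End BadCells.

(** * Rounding to the grid *)

Lemma quadric_close {R : realFieldType} m (c C : 'I_m -> R) (x X : 'I_m.+1 -> R) e :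
  (forall k, `|x k| <= 6) -> (forall k, `|X k| <= 7) ->
  `|x ord0| <= 2 -> `|X ord0| <= 3 ->
  (forall k, `|C k| <= 3) -> (forall k, `|X k - x k| <= e) ->
  (forall k, `|C k - c k| * `|x (lift ord0 k)| <= e) ->
  `|quadric C X - quadric c x| <= 42 * m.+1%:R * e /\
  `|\sum_k C k * X (lift ord0 k) - \sum_k c k * x (lift ord0 k)| <= 4 * m%:R * e.
Proof.
move=> x6 X7 x02 X03 C3 Xx Cx.
have e0 : 0 <= e by apply: le_trans (normr_ge0 _) (Xx ord0).
have ler_sumc (F : 'I_m -> R) u : (forall k, `|F k| <= u) -> `|\sum_k F k| <= u * m%:R.
  move=> Fu; apply: le_trans (ler_norm_sum _ _ _) _.
  rewrite mulr_natr -[m in leRHS]card_ord -sumr_const.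
  by apply: ler_sum => k _.
have s1 : `|\sum_k C k * X (lift ord0 k) - \sum_k c k * x (lift ord0 k)| <= 4 * m%:R * e.
  rewrite -sumrB [leRHS]mulrAC; apply: ler_sumc => k.
  (* The error of [C k] is paired with [x]: only this product is assumed small, which permits a
     coarse grid for the coefficients. *)
  have -> : C k * X (lift ord0 k) - c k * x (lift ord0 k) =
     C k * (X (lift ord0 k) - x (lift ord0 k)) + (C k - c k) * x (lift ord0 k) by ring.
  apply: le_trans (ler_normD _ _) _; rewrite !normrM.
  have : `|C k| * `|X (lift ord0 k) - x (lift ord0 k)| <= 3 * e by apply: ler_pM.
  by have := Cx k; lra.
split=> //.
have s2 : `|\sum_k C k * X (lift ord0 k)| <= 21 * m%:R.
  apply: ler_sumc => k; rewrite normrM.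
  have -> : 21 = 3 * 7 :> R by ring.
  exact: ler_pM.
have sq (a b u v : R) : `|a - b| <= e -> `|a| <= u -> `|b| <= v ->
    `|a ^+ 2 - b ^+ 2| <= (u + v) * e.
  move=> h1 h2 h3; rewrite subr_sqr normrM mulrC.
  by apply: ler_pM => //; apply: le_trans (ler_normD _ _) _; apply: lerD.
have s3 : `|\sum_k X (lift ord0 k) ^+ 2 - \sum_k x (lift ord0 k) ^+ 2|
    <= (13 * e) * m%:R.
  rewrite -sumrB; apply: ler_sumc => k.
  by have := sq _ _ 7 6 (Xx (lift ord0 k)) (X7 _) (x6 _); lra.
have s4 := sq _ _ _ _ (Xx ord0) X03 x02.
have s5 := Xx ord0.
rewrite /quadric; move: s1 s2 s3 s4 s5.
set u := \sum_k C k * _; set v := \sum_k c k * _; set w := \sum_k X _ ^+ 2.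
set z := \sum_k x _ ^+ 2; set Y := X ord0; set y := x ord0.
move=> s1 s2 s3 s4 s5.
have -> : Y ^+ 2 - Y + Y * u + w - (y ^+ 2 - y + y * v + z) =
  (Y ^+ 2 - y ^+ 2) - (Y - y) + (Y - y) * u + y * (u - v) + (w - z) by ring.
have h1 : `|(Y - y) * u| <= e * (21 * m%:R) by rewrite normrM; apply: ler_pM.
have h2 : `|y * (u - v)| <= 2 * (4 * m%:R * e) by rewrite normrM; apply: ler_pM.
apply: le_trans (ler_normD _ _) _.
have t1 : `|Y ^+ 2 - y ^+ 2 - (Y - y) + (Y - y) * u + y * (u - v)| <=
   `|Y ^+ 2 - y ^+ 2| + `|Y - y| + `|(Y - y) * u| + `|y * (u - v)|.
  apply: le_trans (ler_normD _ _) _; rewrite lerD2r.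
  apply: le_trans (ler_normD _ _) _; rewrite lerD2r.
  exact: ler_normB.
have me : 0 <= m%:R * e by rewrite mulr_ge0.
have -> : 42 * m.+1%:R * e = 42 * (m%:R * e) + 42 * e by rewrite -natr1; ring.
move: t1 h1 h2 s3 s4 s5; rewrite /Y /y; clear -me e0; lra.
Qed.

Lemma fin_choice (T : finType) (U : Type) (Q : T -> U -> Prop) :
  (forall x, exists u, Q x u) -> exists f : T -> U, forall x, Q x (f x).
Proof. exact: fin_all_exists. Qed.

Lemma grid_cell {R : archiRealFieldType} K (N M : nat) (x : R) : (0 < N)%N ->
  (2 * M * N < K)%N -> `|x| <= M%:R ->
  exists a : 'I_K, [/\ (a <= 2 * M * N)%N,
    gridpt N M a <= x <= gridpt N M a + N%:R^-1 & `|gridpt N M a - x| <= N%:R^-1].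
Proof.
move=> N0 K0; rewrite ler_norml => xM.
have [a aM ax] := gridpt_approx N M x N0 xM.
have aK : (a < K)%N by apply: leq_ltn_trans K0.
exists (Ordinal aK); split=> //=.
by rewrite ler_norml; move: ax => /andP[]; lra.
Qed.

(** The least power of two above [N * y] is taken. Either it is at most [2], or minimality makes it
    comparable to [N * y]. *)
Lemma dyadic_scale {R : archiRealFieldType} (N L : nat) (y : R) :
  (0 < N)%N -> (14 * N <= 2 ^ L)%N -> y <= 6 ->
  exists e : 'I_L.+1, [/\ (2 ^ e <= 14 * N)%N, N%:R * y <= (2 ^ e)%:R &
    (2 ^ e <= 2)%N \/ (4 <= 2 ^ e)%N /\ (2 ^ e)%:R <= 2 * (N%:R * y)].
Proof.
move=> N0 NL y6; have NR : 1 <= N%:R :> R by rewrite ler1n.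
have Ny : N%:R * y <= N%:R * 6 by apply: ler_wpM2l.
have exL : exists e, N%:R * y <= (2 ^ e)%:R.
  exists L; apply: le_trans Ny _; apply: (@le_trans _ _ (14 * N)%:R).
    by rewrite natrM; lra.
  by rewrite ler_nat.
case: (ex_minnP exL) => e eP emin.
have eL : (e < L.+1)%N.
  rewrite ltnS; apply: emin; apply: le_trans Ny _; apply: (@le_trans _ _ (14 * N)%:R).
    by rewrite natrM; lra.
  by rewrite ler_nat.
exists (Ordinal eL); split=> //=.
  case: e eP emin {eL} => [|e] eP emin; first by rewrite expn0 muln_gt0.
  have : ~~ (N%:R * y <= (2 ^ e)%:R).
    by apply/negP => /emin; rewrite ltnn.
  rewrite -ltNge -(ler_nat R) expnS !natrM => h; lra.
case: e eP emin {eL} => [|[|e]] eP emin; [by left|by left|right; split].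
  by rewrite !expnS mulnA leq_pmulr// expn_gt0.
have : ~~ (N%:R * y <= (2 ^ e.+1)%:R) by apply/negP => /emin; rewrite ltnn.
rewrite -ltNge [(2 ^ e.+2)%N]expnS natrM => h; lra.
Qed.

(** All real data are rounded, and each clause of [bad_cells] is checked to survive. The lower bound
    on [N] keeps the rounding of the gradient below half of [gap]. *)
Lemma bad_cells_approx {R : archiRealFieldType} (n m N L : nat)
    (h : 'I_n -> 'I_m.+1 -> R) (b : 'I_m.+1 -> 'I_m.+1 -> R) (c : 'I_m -> R) :
  (0 < N)%N -> (0 < L)%N -> (14 * N <= 2 ^ L)%N ->
  14 * m.+1%:R <= N%:R * gap (R := R) m ^+ 2 ->
  (forall k, `|c k| <= 2) -> (forall j, 0 <= b j ord0 <= 2) ->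
  (forall j k, `|b j (lift ord0 k)| <= b (lift ord0 k) (lift ord0 k)) ->
  (forall j k, `|b j (lift ord0 k)| <= 6) ->
  (forall k, b ord0 k = (k == ord0)%:R) ->
  (forall j k : 'I_m.+1, (j < k)%N -> b j k = 0) ->
  (forall j, quadric c (b j) = 0 /\
     (\sum_k c k * b j (lift ord0 k)) ^+ 2 <= 4 * \sum_k b j (lift ord0 k) ^+ 2) ->
  (forall r j, `|h r j| <= L%:R) ->
  (forall r k, `|\sum_j h r j * b j k| <= 6 * n%:R * L%:R / N%:R) ->
  exists2 f, f \in bad_cells (R := R) n m N L & forall r j,
    gridpt N L (f r j) <= h r j <= gridpt N L (f r j) + N%:R^-1.
Proof.
move=> N0 L0 NL Ngap c2 b02 bpiv b6 b0 btri bquad hL hb.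
have NR : 0 < N%:R :> R by rewrite ltr0n.
have N1 : 1 <= N%:R :> R by rewrite ler1n.
have iN0 : 0 < N%:R^-1 :> R by rewrite invr_gt0.
have iN1 : N%:R^-1 <= 1 :> R by rewrite invf_le1.
have b6' j k : `|b j k| <= 6.
  case: (unliftP ord0 k) => [k'|] ->; first exact: b6.
  by have /andP[? ?] := b02 j; rewrite ger0_norm//; lra.
have /fin_choice[e eP] : forall k : 'I_m, exists e : 'I_L.+1, [/\ (2 ^ e <= 14 * N)%N,
    N%:R * b (lift ord0 k) (lift ord0 k) <= (2 ^ e)%:R &
    (2 ^ e <= 2)%N \/ (4 <= 2 ^ e)%N /\
      (2 ^ e)%:R <= 2 * (N%:R * b (lift ord0 k) (lift ord0 k))].
  move=> k; apply: dyadic_scale => //.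
  exact: le_trans (ler_norm _) (b6 _ _).
pose eb : {ffun 'I_m -> 'I_L.+1} := [ffun k => e k].
have /fin_choice[cc ccP] : forall k, exists a : 'I_(cellN N L),
   [/\ (a <= 2 * 2 * 2 ^ e k)%N,
    gridpt (2 ^ e k) 2 a <= c k <= gridpt (2 ^ e k) 2 a + (2 ^ e k)%:R^-1 &
    `|gridpt (2 ^ e k) 2 a - c k| <= (2 ^ e k)%:R^-1].
  move=> k; apply: grid_cell => //; first by rewrite expn_gt0.
  rewrite /cellN ltnS; apply: leq_trans (leq_addl _ _).
  by rewrite leq_mul2l leq_pexp2l// -ltnS ltn_ord.
pose ec : {ffun 'I_m -> 'I_(cellN N L)} := [ffun k => cc k].
have /fin_choice[ll llP] : forall j : 'I_m, exists l : {ffun 'I_m.+1 -> 'I_(cellN N L)},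
    forall k, `|gridpt N 7 (l k) - b (lift ord0 j) k| <= N%:R^-1.
  move=> j.
  have /fin_choice[g gP] : forall k, exists a : 'I_(cellN N L), [/\ (a <= 2 * 7 * N)%N,
      gridpt N 7 a <= b (lift ord0 j) k <= gridpt N 7 a + N%:R^-1 &
      `|gridpt N 7 a - b (lift ord0 j) k| <= N%:R^-1].
    move=> k; apply: grid_cell => //.
      by rewrite /cellN ltnS -addnA; apply: leq_trans (leq_addl _ _); exact: leq_addr.
    by apply: le_trans (b6' _ _) _; rewrite ler_nat.
  by exists [ffun k => g k] => k; rewrite ffunE; case: (gP k).
pose el : {ffun 'I_m -> {ffun 'I_m.+1 -> 'I_(cellN N L)}} := [ffun j => ll j].
have /fin_choice[ff ffP] : forall r : 'I_n, exists f : {ffun 'I_m.+1 -> 'I_(cellN N L)},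
    forall j, [/\ (f j <= 2 * L * N)%N,
    gridpt N L (f j) <= h r j <= gridpt N L (f j) + N%:R^-1 &
    `|gridpt N L (f j) - h r j| <= N%:R^-1].
  move=> r.
  have /fin_choice[g gP] : forall j, exists a : 'I_(cellN N L), [/\ (a <= 2 * L * N)%N,
      gridpt N L a <= h r j <= gridpt N L a + N%:R^-1 &
      `|gridpt N L a - h r j| <= N%:R^-1].
    move=> k; apply: grid_cell => //.
    by rewrite /cellN ltnS -addnA; exact: leq_addr.
  by exists [ffun k => g k] => k; rewrite ffunE; exact: gP.
exists [ffun r => ff r]; last by move=> r j; rewrite ffunE; case: (ffP r j).
have trib j k : `|tri (R := R) m N L el j k - b j k| <= N%:R^-1.
  rewrite /tri; case: (unliftP ord0 j) => [j'|] ->.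
    by rewrite /entry ffunE; exact: llP.
  by rewrite b0 subrr normr0 ltW.
have gap0 : 0 < gap (R := R) m by rewrite invr_gt0 mulr_gt0 ?ltr0n.
have m1 : 1 <= m.+1%:R :> R by rewrite ler1n.
have gap1 : gap (R := R) m <= 1.
  by rewrite /gap invf_le1 ?mulr_gt0 ?ltr0n//; lra.
have scE k : scale m N L eb (lift ord0 k) = (2 ^ e k)%N.
  by rewrite /scale liftK ffunE.
have sc0 : scale m N L eb ord0 = N by rewrite /scale unlift_none.
have b_sc j k : `|b j (lift ord0 k)| <= (2 ^ e k)%:R / N%:R.
  rewrite ler_pdivlMr// mulrC; case: (eP k) => _ h1 _.
  by apply: le_trans h1; apply: ler_wpM2l => //; exact: ltW.
have e1 k : 1 <= (2 ^ e k)%:R :> R by rewrite ler1n expn_gt0.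
rewrite inE; apply/existsP; exists eb; apply/andP; split.
  by rewrite inE; apply/forallP => k; rewrite ffunE; case: (eP k).
apply/existsP; exists ec; apply/andP; split.
  by rewrite inE; apply/forallP => k; rewrite !ffunE; case: (ccP k).
apply/existsP; exists el; apply/andP; split; last first.
  apply/forallP => r; rewrite ffunE; apply/andP; split.
    by apply/forallP => j; case: (ffP r j).
  apply/forallP => k.
  have -> : \sum_(j : 'I_m.+1 | (k <= j)%N) gridpt N L (ff r j) * tri m N L el j k
    = \sum_(j : 'I_m.+1 | (k <= j)%N)
        (gridpt N L (ff r j) * tri m N L el j k - h r j * b j k) + \sum_j h r j * b j k.
    have -> : \sum_j h r j * b j k = \sum_(j : 'I_m.+1 | (k <= j)%N) h r j * b j k.
      rewrite (bigID (fun j : 'I_m.+1 => (k <= j)%N))/= [X in _ + X]big1 ?addr0// => j.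
      by rewrite -ltnNge => /btri ->; rewrite mulr0.
    by rewrite -big_split/=; apply: eq_bigr => j _; rewrite subrK.
  apply: le_trans (ler_normD _ _) _.
  have -> : slackH n m * L%:R / N%:R =
     8 * m.+1%:R * L%:R / N%:R + 6 * n%:R * L%:R / N%:R :> R by rewrite /slackH; ring.
  apply: lerD => //.
  apply: le_trans (ler_norm_sum _ _ _) _.
  apply: (@le_trans _ _ (\sum_(j < m.+1) 8 * L%:R / N%:R)).
    rewrite big_mkcond/=; apply: ler_sum => j _; case: ifP => // _; last first.
      by rewrite divr_ge0 ?mulr_ge0.
    have -> : gridpt N L (ff r j) * tri m N L el j k - h r j * b j k =
       (gridpt N L (ff r j) - h r j) * tri m N L el j k
        + h r j * (tri m N L el j k - b j k) by ring.
    apply: le_trans (ler_normD _ _) _; rewrite !normrM.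
    have t7 : `|tri (R := R) m N L el j k| <= 7.
      rewrite -[tri _ _ _ _ _ _](subrK (b j k)).
      apply: le_trans (ler_normD _ _) _.
      by have := trib j k; have := b6' j k; move: iN1; clear; lra.
    have [_ _ f1] := ffP r j.
    have u1 : `|gridpt N L (ff r j) - h r j| * `|tri m N L el j k| <= N%:R^-1 * 7.
      exact: ler_pM.
    have u2 : `|h r j| * `|tri m N L el j k - b j k| <= L%:R * N%:R^-1.
      exact: ler_pM.
    have u3 : 1 * N%:R^-1 <= L%:R * N%:R^-1 :> R.
      by apply: ler_wpM2r; [exact: ltW|rewrite ler1n].
    by move: u1 u2 u3; clear; lra.
  by rewrite sumr_const card_ord -mulr_natl le_eqVlt; apply/orP; left; apply/eqP; ring.
have tri_e j k : tri (R := R) m N L el (lift ord0 j) k = entry m N L (ll j) k.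
  by rewrite /tri liftK ffunE.
rewrite inE; apply/andP; split.
  apply/forallP => k; rewrite ffunE; have [_ _ [->//|[e4 e2]]] := eP k.
  apply/orP; right.
  have := trib (lift ord0 k) (lift ord0 k).
  have bk0 : 0 <= b (lift ord0 k) (lift ord0 k).
    by apply: le_trans (normr_ge0 _) (bpiv (lift ord0 k) k).
  (* With [s = 2 ^ e k / N], the exact pivot is at least [s / 2] and rounding costs
     [1 / N <= s / 4], which leaves [s / 4]. *)
  have e4R : 4 <= (2 ^ e k)%:R :> R by rewrite ler_nat.
  have : (2 ^ e k)%:R / N%:R <= 2 * b (lift ord0 k) (lift ord0 k).
    by rewrite ler_pdivrMr//; move: e2; clear; lra.
  have : 4 / N%:R <= (2 ^ e k)%:R / N%:R :> R.
    by rewrite ler_wpM2r// ltW.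
  have -> : (2 ^ e k)%:R / (4 * N%:R) = (2 ^ e k)%:R / N%:R / 4 :> R.
    by field; rewrite gt_eqF.
  set T := tri _ _ _ _ _ _; set B := b _ _; set s := ((2 ^ e k)%:R / N%:R).
  move=> s1 s2; rewrite ler_norml => /andP[s3 s4].
  by apply: le_trans (ler_norm _); move: s1 s2 s3; clear; lra.
apply/forallP => j; rewrite ffunE.
pose X := entry (R := R) m N L (ll j); pose x := b (lift ord0 j).
pose C := coeff (R := R) m N L eb ec; rewrite /near_quadric -/X -/C.
have Xx k : `|X k - x k| <= N%:R^-1 by exact: llP.
have CE k : C k = gridpt (2 ^ e k) 2 (cc k).
  by rewrite /C /coeff scE ffunE.
have Cc k : `|C k - c k| <= (2 ^ e k)%:R^-1 by rewrite CE; case: (ccP k).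
have C3 k : `|C k| <= 3.
  rewrite -[C k](subrK (c k)); apply: le_trans (ler_normD _ _) _.
  have : (2 ^ e k)%:R^-1 <= 1 :> R by rewrite invf_le1 ?ltr0n ?expn_gt0.
  by have := Cc k; have := c2 k; clear; lra.
have X_le k u : `|x k| <= u -> `|X k| <= u + N%:R^-1.
  move=> xu; rewrite -[X k](subrK (x k)); apply: le_trans (ler_normD _ _) _.
  by have := Xx k; move: xu; clear; lra.
have x02 : `|x ord0| <= 2.
  by have /andP[h1 h2] := b02 (lift ord0 j); rewrite ger0_norm.
have X7 k : `|X k| <= 7 by apply: le_trans (X_le _ _ (b6' _ _)) _; move: iN1; clear; lra.
have X03 : `|X ord0| <= 3 by apply: le_trans (X_le _ _ x02) _; move: iN1; clear; lra.
(* The coefficient is known to within [1 / scale] and its variable is at most [scale / N]. *)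
have Cx k : `|C k - c k| * `|x (lift ord0 k)| <= N%:R^-1.
  apply: (@le_trans _ _ ((2 ^ e k)%:R^-1 * ((2 ^ e k)%:R / N%:R))).
    by apply: ler_pM => //; exact: b_sc.
  by rewrite mulKf// gt_eqF// ltr0n expn_gt0.
have [q1 q2] := quadric_close m c C x X _ (b6' _) X7 x02 X03 C3 Xx Cx.
have [xq xq2] := bquad (lift ord0 j).
have gN : 14 * m.+1%:R <= N%:R * gap (R := R) m.
  apply: le_trans Ngap _; rewrite expr2; apply: ler_wpM2l; first exact: ltW.
  by rewrite ler_piMl// ltW.
have gN' : 14 * m.+1%:R / N%:R <= gap (R := R) m by rewrite ler_pdivrMr// [leRHS]mulrC.
apply/and3P; split.
- apply/forallP => k; case: (unliftP ord0 k) => [k'|] ->.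
    rewrite scE; apply: le_trans (X_le _ _ (b_sc _ _)) _.
    have : 1 / N%:R <= (2 ^ e k')%:R / N%:R :> R by rewrite ler_wpM2r// ltW.
    by move: (e1 k') iN0; rewrite div1r; clear; lra.
  by rewrite sc0 divff ?mulr1 ?gt_eqF.
- by move: q1; rewrite xq subr0.
apply/existsP.
have [g0|[k [g1 g2]]] := quadric_gradient R m (x ord0) (fun k => x (lift ord0 k)) c
   (b02 (lift ord0 j)) c2 (b6 (lift ord0 j)) xq xq2.
  exists ord0; rewrite sc0; apply/andP; split.
    by rewrite ler_piMl// ltW.
  rewrite /dquadric unlift_none; move: g0; rewrite -/(gap m).
  have := Xx ord0; move: q2.
  set U := \sum_k _; set V := \sum_k _ => q2 X0 g0.
  have : `|2 * x ord0 - 1 + V| <= `|2 * X ord0 - 1 + U| + (2 * `|X ord0 - x ord0| + `|U - V|).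
    have -> : 2 * x ord0 - 1 + V =
      (2 * X ord0 - 1 + U) - (2 * (X ord0 - x ord0) + (U - V)) by ring.
    apply: le_trans (ler_normB _ _) _; rewrite lerD2l.
    by apply: le_trans (ler_normD _ _) _; rewrite normrM (@ger0_norm _ 2).
  have mN : 0 <= m%:R * N%:R^-1 :> R by rewrite mulr_ge0// ltW.
  have gNE : 14 * m.+1%:R / N%:R = 14 * (m%:R * N%:R^-1) + 14 * N%:R^-1 :> R.
    by rewrite -natr1; ring.
  rewrite gNE in gN'.
  by move: g0 q2 X0 gN' mN iN0; clear; lra.
exists (lift ord0 k); rewrite scE; apply/andP; split.
  rewrite mulrC; apply: (@le_trans _ _ (N%:R * `|x (lift ord0 k)|)).
    by apply: ler_wpM2l => //; exact: ltW.
  by have := b_sc (lift ord0 j) k; rewrite ler_pdivlMr// mulrC.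
rewrite /dquadric liftK; move: g2; rewrite -/(gap m) => g2.
(* In the steep direction the coordinate is at least [gap], hence the scale at least [gap * N], and
   the coefficient itself is finely resolved. *)
have eg : (2 ^ e k)%:R^-1 <= gap m / (14 * m.+1%:R) :> R.
  have : gap m * N%:R <= (2 ^ e k)%:R :> R.
    rewrite mulrC; apply: (@le_trans _ _ (N%:R * `|x (lift ord0 k)|)).
      by apply: ler_wpM2l => //; exact: ltW.
    by have := b_sc (lift ord0 j) k; rewrite ler_pdivlMr// mulrC.
  move=> gNe; rewrite -[_^-1]mul1r ler_pdivrMr ?ltr0n ?expn_gt0//.
  rewrite mulrAC ler_pdivlMr ?mulr_gt0 ?ltr0n// mul1r.
  apply: le_trans Ngap _; rewrite expr2 mulrA mulrC; apply: ler_wpM2l; first exact: ltW.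
  by rewrite mulrC.
have eg' : (2 ^ e k)%:R^-1 <= gap m / 14 :> R.
  apply: le_trans eg _; apply: ler_wpM2l; first exact: ltW.
  by rewrite lef_pV2 ?posrE ?mulr_gt0 ?ltr0n//; move: m1; clear; lra.
have iNg : N%:R^-1 <= gap m / 14 :> R.
  apply: le_trans (_ : 14 * m.+1%:R / N%:R / 14 <= _).
    have : 1 * N%:R^-1 <= m.+1%:R * N%:R^-1 :> R by apply: ler_wpM2r => //; exact: ltW.
    by clear; lra.
  by apply: ler_wpM2r; rewrite ?invr_ge0.
have : `|2 * x (lift ord0 k) + x ord0 * c k| <= `|2 * X (lift ord0 k) + X ord0 * C k|
   + (2 * N%:R^-1 + N%:R^-1 * 3 + 2 * (2 ^ e k)%:R^-1).
  have -> : 2 * x (lift ord0 k) + x ord0 * c k = (2 * X (lift ord0 k) + X ord0 * C k)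
    - (2 * (X (lift ord0 k) - x (lift ord0 k)) + (X ord0 - x ord0) * C k
       + x ord0 * (C k - c k)) by ring.
  apply: le_trans (ler_normB _ _) _; rewrite lerD2l.
  apply: le_trans (ler_normD _ _) _; apply: lerD; last by rewrite normrM; apply: ler_pM.
  apply: le_trans (ler_normD _ _) _; apply: lerD; last by rewrite normrM; apply: ler_pM.
  by rewrite normrM (@ger0_norm _ 2)//; apply: ler_wpM2l.
by move: g2 eg' iNg; clear; lra.
Qed.

(** * The semidefinite relaxation *)

From mathcomp Require Import all_classical all_reals all_analysis.
From mathcomp Require Import measurable_realfun.
Import Order.TTheory GRing.Theory Num.Theory.
Import numFieldNormedType.Exports.

Section Relaxation.
Context {R : realType} {n m : nat}.
Implicit Types (H : 'M[R]_(n, m)) (y : 'cV[R]_n) (X : 'M[R]_(m + 1)) (t : 'cV[R]_m).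

(** The inner product of the Gram vectors of [X]: basis vectors stand for them, so no factorisation
    of [X] is needed. *)
Definition form {k} (X : 'M[R]_k) (a b : 'cV[R]_k) : R := (a^T *m X *m b) 0 0.

Lemma formC {k} (X : 'M[R]_k) a b : X^T = X -> form X a b = form X b a.
Proof.
move=> XT; rewrite /form -[in LHS](trmxK (a^T *m X *m b)) mxE.
by rewrite !trmx_mul trmxK XT mulmxA.
Qed.

Lemma formDl {k} (X : 'M[R]_k) a b c : form X (a + b) c = form X a c + form X b c.
Proof. by rewrite /form linearD/= !mulmxDl mxE. Qed.

Lemma formZl {k} (X : 'M[R]_k) u a c : form X (u *: a) c = u * form X a c.
Proof. by rewrite /form linearZ/= -!scalemxAl mxE. Qed.

Lemma form_delta {k} (X : 'M[R]_k) i j : form X (delta_mx i 0) (delta_mx j 0) = X i j.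
Proof. by rewrite /form trmx_delta -rowE -colE !mxE. Qed.

Definition lift_row H y (r : 'I_n) : 'cV[R]_(m + 1) := (row r (row_mx H (- y)))^T.

(** [Lmat] is the Gram matrix of the columns of [row_mx H (- y)], so the objective is a sum over
    receive antennas of squared lengths. *)
Lemma mxtrace_Lmat H y X :
  \tr (Lmat H y *m X) = \sum_r form X (lift_row H y r) (lift_row H y r).
Proof.
have -> : Lmat H y = (row_mx H (- y))^T *m row_mx H (- y).
  rewrite tr_row_mx mul_col_row /Lmat [(- y)^T]linearN/=.
  by rewrite mulmxN mulNmx mulNmx mulmxN opprK.
rewrite -mulmxA mxtrace_mulC /mxtrace; apply: eq_bigr => r _.
rewrite /form trmxK -row_mul [LHS]mxE [RHS]mxE.
by apply: eq_bigr => k _; rewrite !mxE.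
Qed.

Lemma lift_rowE H y r : lift_row H y r =
  \sum_j H r j *: delta_mx (lshift 1 j) 0 - y r 0 *: delta_mx (rshift m ord0) 0.
Proof.
apply/colP => i; rewrite !mxE summxE; case: (split_ordP i) => k ->.
  rewrite (bigD1 k)//= !mxE !eqxx mulr1 big1 => [|j jk]; last first.
    by rewrite !mxE (inj_eq (@lshift_inj _ _)) eq_sym (negPf jk) mulr0.
  by rewrite eq_lrshift mulr0 subr0 addr0.
rewrite big1 => [|j _]; last by rewrite !mxE eq_rlshift mulr0.
by rewrite !mxE !ord1 !eqxx mulr1 add0r.
Qed.

Definition rank1 t : 'M[R]_(m + 1) := col_mx t 1%:M *m (col_mx t 1%:M)^T.

Lemma rank1E t i : rank1 t (lshift 1 i) (rshift m ord0) = t i 0.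
Proof.
by rewrite [LHS]mxE big_ord1 [X in _ * X]mxE col_mxEu col_mxEd mxE eqxx mulr1.
Qed.

Lemma form_rank1 t a b : form (rank1 t) a b =
  (a^T *m col_mx t 1%:M) 0 0 * (b^T *m col_mx t 1%:M) 0 0.
Proof.
rewrite /form /rank1 !mulmxA -mulmxA mxE big_ord1; congr (_ * _).
by rewrite -[in LHS](trmxK b) -trmx_mul mxE.
Qed.

Lemma rank1_feasible t : pm1vec t -> sdp_feasible (rank1 t).
Proof.
move=> pt; split=> [i|].
  rewrite [LHS]mxE big_ord1 [X in _ * X]mxE; case: (split_ordP i) => k ->.
    by rewrite col_mxEu; case: (pt k) => ->; rewrite ?mulrNN mulr1.
  by rewrite col_mxEd !mxE !ord1 eqxx mulr1.
split; first by rewrite /rank1 trmx_mul trmxK.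
by move=> z; have := form_rank1 t z z; rewrite /form => ->; rewrite -expr2 sqr_ge0.
Qed.

Lemma mxtrace_rank1 H y t : \tr (Lmat H y *m rank1 t) = sqnorm (y - H *m t).
Proof.
rewrite mxtrace_Lmat; apply: eq_bigr => r _.
rewrite form_rank1 -expr2 /lift_row trmxK -row_mul mul_row_col mulmx1 !mxE.
by rewrite -sqrrN opprD opprK addrC.
Qed.

Lemma feasible_form X : sdp_feasible X ->
  [/\ forall a b, form X a b = form X b a, forall a, 0 <= form X a a &
      forall i, form X (delta_mx i 0) (delta_mx i 0) = 1].
Proof.
move=> [X1 [XT X0]]; split=> [a b|a|i]; [exact: formC|exact: X0|].
by rewrite form_delta.
Qed.

Lemma feasible_le1 X i j : sdp_feasible X -> `|X i j| <= 1.
Proof.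
move=> /feasible_form[fC f0 f1]; rewrite -form_delta -[leRHS]mulr1.
by apply: (sip_norm_le (form X) fC (formDl X) (formZl X) f0); rewrite ?f1 ?expr1n.
Qed.

(** Each residual of the last column of [X] is, up to sign, the component of [lift_row] along the
    unit vector of the last index; apply Cauchy-Schwarz row by row. *)
Lemma sqnorm_le_mxtrace H y X : sdp_feasible X ->
  sqnorm (y - H *m \col_i X (lshift 1 i) (rshift m ord0)) <= \tr (Lmat H y *m X).
Proof.
move=> /feasible_form[fC f0 f1]; rewrite mxtrace_Lmat; apply: ler_sum => r _.
have -> : (y - H *m \col_i X (lshift 1 i) (rshift m ord0)) r 0 =
   - form X (lift_row H y r) (delta_mx (rshift m ord0) 0).
  rewrite lift_rowE (sipB _ (formDl X) (formZl X)) (sip_sum _ (formDl X) (formZl X)) formZl f1 opprB mulr1.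
  rewrite !mxE; congr (_ - _); apply: eq_bigr => j _.
  by rewrite formZl form_delta mxE.
rewrite sqrrN; have := sip_CauchySchwarz (form X) fC (formDl X) (formZl X) f0 (lift_row H y r)
  (delta_mx (rshift m ord0) 0).
by rewrite f1 mulr1.
Qed.

(* A relaxed point at least as good as the transmitted vector decides at least one
   entry wrongly. *)
Definition misled H (v : 'cV[R]_n) (s : 'cV[R]_m) : Prop :=
  exists X, [/\ sdp_feasible X, \tr (Lmat H (H *m s + v) *m X) <= sqnorm v &
    exists i, s i 0 * X (lshift 1 i) (rshift m ord0) <= 0].

Lemma colN (s t : 'cV[R]_m) : s != t -> exists i, s i 0 != t i 0.
Proof.
move=> st; apply/existsP; apply: contraNT st; rewrite negb_exists => /forallP h.
by apply/eqP/colP => i; apply/eqP; have := h i; rewrite negbK.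
Qed.

(** The transmitted vector gives a feasible rank-one point of cost [sqnorm v], which the optimum
    cannot exceed. The product can vanish because [sgn] sends [0] to [-1]. *)
Lemma SDR_misled H v s X : pm1vec s -> is_SDR_opt H (H *m s + v) X ->
  sdr_decision X != s -> misled H v s.
Proof.
move=> ps [fX oX] /colN[i]; rewrite mxE => dec_i.
exists X; split=> //.
  have := oX _ (rank1_feasible _ ps); rewrite mxtrace_rank1.
  by rewrite addrAC subrr add0r.
exists i; move: dec_i; rewrite /sgn; case: ltP => h; case: (ps i) => ->.
- by rewrite eqxx.
- by rewrite mulN1r oppr_le0 => _; exact: ltW.
- by rewrite mul1r.
- by rewrite eqxx.
Qed.

Lemma ML_misled H v s t : pm1vec s -> is_ML_point H (H *m s + v) t ->
  t != s -> misled H v s.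
Proof.
move=> ps [pt ot] /colN[i ts].
exists (rank1 t); split; first exact: rank1_feasible.
  rewrite mxtrace_rank1; apply: le_trans (ot _ ps) _.
  by rewrite addrAC subrr add0r.
exists i; rewrite rank1E; move: ts.
by case: (ps i) => ->; case: (pt i) => ->; rewrite ?eqxx// ?mulr1 ?mul1r ?lerN10.
Qed.

End Relaxation.

(** [unit_vectors_triangular] is applied to the form of [X], with the signs of [s] absorbed in the
    vectors; the result is rounded. The permutation [p] records the order of the pivots. *)
Lemma misled_bad_cells {R : realType} (n m N L : nat) (H : 'M[R]_(n, m.+1))
    (v : 'cV[R]_n) (s : 'cV[R]_m.+1) :
  (0 < N)%N -> (0 < L)%N -> (14 * N <= 2 ^ L)%N ->
  14 * m.+1%:R <= N%:R * gap (R := R) m ^+ 2 ->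
  pm1vec s -> (forall r j, `|H r j| <= L%:R) -> (forall r, `|v r 0| <= L%:R / N%:R) ->
  misled H v s ->
  exists (p : 'S_m.+1), exists2 f, f \in bad_cells (R := R) n m N L & forall r j,
    gridpt N L (f r j) <= s (p j) 0 * H r (p j) <= gridpt N L (f r j) + N%:R^-1.
Proof.
move=> N0 L0 NL Ngap ps HL vL [X [fX trX [i0 si0]]].
have NR : 0 < N%:R :> R by rewrite ltr0n.
have [fC f0 f1] := feasible_form X fX.
have s1 j : s j 0 * s j 0 = 1 by case: (ps j) => ->; rewrite ?mulrNN mulr1.
pose p0 : 'cV[R]_(m.+1 + 1) := delta_mx (rshift m.+1 ord0) 0.
pose pp j : 'cV[R]_(m.+1 + 1) := s j 0 *: delta_mx (lshift 1 j) 0.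
have pp1 j : form X (pp j) (pp j) = 1.
  by rewrite formZl fC formZl f1 mulr1 s1.
have ppi0 : form X (pp i0) p0 <= 0 by rewrite formZl form_delta.
have [p [b [c [[c2 b02 bpiv b6] b0 btri bq hb]]]] :=
  unit_vectors_triangular (form X) fC (formDl X) (formZl X) f0 m p0 pp i0 (f1 _) pp1 ppi0.
pose V : R := n%:R * (L%:R / N%:R).
have LN : 0 <= L%:R / N%:R :> R by rewrite divr_ge0.
have V0 : 0 <= V by rewrite mulr_ge0.
have vV : sqnorm v <= V ^+ 2.
  apply: (@le_trans _ _ (\sum_(r < n) (L%:R / N%:R) ^+ 2)).
    apply: ler_sum => r _; rewrite -real_normK ?num_real//.
    by apply: lerXn2r; rewrite ?nnegrE.
  rewrite sumr_const card_ord -[leLHS]mulr_natl /V [(n%:R * _) ^+ 2]exprMn; apply: ler_wpM2r; first exact: sqr_ge0.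
  by rewrite -natrX ler_nat; case: (n) => // k; exact: leq_pmulr.
have hB r : form X (\sum_j (s j 0 * H r j) *: (pp j - p0))
     (\sum_j (s j 0 * H r j) *: (pp j - p0)) <= (2 * V) ^+ 2.
  set g := lift_row H (H *m s + v) r.
  (* The combination is row [r] of the relaxed residual plus the noise along [p0]; both have length
     at most [V]. *)
  have -> : \sum_j (s j 0 * H r j) *: (pp j - p0) = g + v r 0 *: p0.
    rewrite /g lift_rowE -/p0 !mxE scalerDl opprD addrA subrK.
    rewrite scaler_suml -sumrB; apply: eq_bigr => j _.
    by rewrite scalerBr /pp scalerA mulrAC s1 mul1r [s j 0 * _]mulrC.
  have gV : form X g g <= V ^+ 2.
    apply: le_trans vV; apply: le_trans trX; rewrite mxtrace_Lmat.
    by rewrite [leRHS](bigD1 r)//= lerDl sumr_ge0.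
  have vrV : v r 0 ^+ 2 <= V ^+ 2.
    by apply: le_trans vV; rewrite /sqnorm (bigD1 r)//= lerDl sumr_ge0// => k _; exact: sqr_ge0.
  (* Nonnegativity here bounds the square of the sum by twice the sum of the squares. *)
  have := f0 (g - v r 0 *: p0).
  rewrite (sipB _ (formDl X) (formZl X)) !(sipBr _ fC (formDl X) (formZl X)) !formDl !(sipDr _ fC (formDl X)).
  rewrite !formZl !(sipZr _ fC (formZl X)) f1 (fC p0); move: gV vrV; rewrite !expr2.
  lra.
have h1 r j : `|s (p j) 0 * H r (p j)| <= L%:R.
  by rewrite normrM; case: (ps (p j)) => ->; rewrite ?normrN normr1 mul1r; exact: HL.
have h2 r k : `|\sum_j s (p j) 0 * H r (p j) * b j k| <= 6 * n%:R * L%:R / N%:R.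
  have V20 : 0 <= 2 * V by rewrite mulr_ge0.
  have := hb (fun j => s j 0 * H r j) (2 * V) V20 (hB r) k.
  by congr (_ <= _); rewrite /V; ring.
have [f fB fP] := bad_cells_approx n m N L (fun r j => s (p j) 0 * H r (p j)) b c
  N0 L0 NL Ngap c2 b02 bpiv b6 b0 btri bq h1 h2.
by exists p, f.
Qed.

(** * A failure event for both detectors *)

Definition flip_first {R : realType} m : 'cV[R]_m.+1 :=
  \col_j (if j == ord0 then -1 else 1).

Lemma flip_first_pm1 {R : realType} m : pm1vec (flip_first (R := R) m).
Proof. by move=> j; rewrite mxE; case: ifP; [right|left]. Qed.

(** The residual of [flip_first m] is [2 H e_1 + v], tiny compared with [w]. A vector [z] fitting as
    well has almost the same image; since the columns are nearly orthogonal, its first entry is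
    close to [-1]. Allowing all [z] in the cube covers both detectors. *)
Lemma first_entry_lost {R : realType} (n m : nat) (mn : (m < n)%N)
    (H : 'M[R]_(n, m.+1)) (v : 'cV[R]_n) (z : 'cV[R]_m.+1) (w : R) :
  0 < w ->
  (forall r j, `|H r j - (r == j :> nat)%:R * (if j == ord0 then w else 1)|
     <= (100 * n%:R)^-1 * (if j == ord0 then w else 1)) ->
  (forall r, `|v r 0 + 2 * ((r == 0 :> nat)%:R * w)| <= (100 * n%:R)^-1 * w) ->
  (forall j, `|z j 0| <= 1) ->
  sqnorm (H *m const_mx 1 + v - H *m z)
    <= sqnorm (H *m const_mx 1 + v - H *m flip_first m) ->
  z ord0 0 < 0.
Proof.
move=> w0 Hw vw z1; set ones : 'cV[R]_m.+1 := const_mx 1 => le_sq.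
have n1 : 1 <= n%:R :> R by rewrite ler1n; apply: leq_ltn_trans mn.
pose d : R := (100 * n%:R)^-1.
have d0 : 0 < d by rewrite invr_gt0; lra.
have nd : n%:R * d = 100^-1 by rewrite /d; field; lra.
have d1 : d <= 100^-1 by rewrite -nd ler_peMl// ltW.
have md : m%:R * d <= 100^-1.
  by rewrite -nd; apply: ler_wpM2r; [exact: ltW|rewrite ler_nat ltnW].
have H0 r : `|H r ord0 - (r == 0 :> nat)%:R * w| <= d * w.
  by have := Hw r ord0; rewrite eqxx.
have Hl r (k : 'I_m) : `|H r (lift ord0 k) - (r == k.+1 :> nat)%:R| <= d.
  by have := Hw r (lift ord0 k); rewrite [lift _ _ == _]eq_sym (negPf (neq_lift _ _)) lift0 !mulr1.
have e2 r : `|2 * H r ord0 + v r 0| <= 3 * (d * w).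
  have -> : 2 * H r ord0 + v r 0 =
    2 * (H r ord0 - (r == 0 :> nat)%:R * w) + (v r 0 + 2 * ((r == 0 :> nat)%:R * w)).
    by ring.
  apply: le_trans (ler_normD _ _) _; rewrite normrM (@ger0_norm _ 2)//.
  have := H0 r; have := vw r; rewrite -/d; clear; lra.
have c1 r : (H *m ones) r 0 = H r ord0 + \sum_(k < m) H r (lift ord0 k).
  rewrite mxE big_ord_recl [ones _ _]mxE mulr1; congr (_ + _).
  by apply: eq_bigr => k _; rewrite mxE mulr1.
have c2 (u : 'cV[R]_m.+1) r :
    (H *m u) r 0 = H r ord0 * u ord0 0 + \sum_(k < m) H r (lift ord0 k) * u (lift ord0 k) 0.
  by rewrite mxE big_ord_recl.
have c3 (u : 'cV[R]_m.+1) r : (H *m ones + v - H *m u) r 0 =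
    (H *m ones) r 0 + v r 0 - (H *m u) r 0.
  by rewrite [LHS]mxE [X in X + _]mxE [X in _ + X]mxE.
have tE r : (H *m ones + v - H *m flip_first m) r 0 = 2 * H r ord0 + v r 0.
  rewrite c3 c1 c2 mxE eqxx.
  have -> : \sum_(k < m) H r (lift ord0 k) * flip_first m (lift ord0 k) 0 =
    \sum_(k < m) H r (lift ord0 k).
    by apply: eq_bigr => i _; rewrite mxE eq_sym (negPf (neq_lift _ _)) mulr1.
  by ring.
have dw0 : 0 < d * w by rewrite mulr_gt0.
have e3 r : `|(H *m ones + v - H *m z) r 0| <= 3 * (n%:R * (d * w)).
  have dwn : 0 <= 3 * (n%:R * (d * w)).
    by rewrite mulr_ge0// mulr_ge0// ltW.
  rewrite -(@ler_pXn2r _ 2)// ?nnegrE// real_normK ?num_real//.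
  apply: (@le_trans _ _ (sqnorm (H *m ones + v - H *m z))).
    by rewrite /sqnorm (bigD1 r)//= lerDl sumr_ge0// => k _; exact: sqr_ge0.
  apply: le_trans le_sq _; apply: (@le_trans _ _ (\sum_(r < n) (3 * (d * w)) ^+ 2)).
    apply: ler_sum => k _; rewrite tE -real_normK ?num_real//.
    by apply: lerXn2r; rewrite ?nnegrE// mulr_ge0// ltW.
  rewrite sumr_const card_ord -[leLHS]mulr_natl.
  have -> : (3 * (n%:R * (d * w))) ^+ 2 = n%:R ^+ 2 * (3 * (d * w)) ^+ 2 by ring.
  apply: ler_wpM2r; first exact: sqr_ge0.
  by rewrite expr2 ler_peMl// ler0n.
(* The entries of [flip_first m - z], to be bounded through their image under [H]. *)
pose q (k : 'I_m) := 1 - z (lift ord0 k) 0; pose q0 := -1 - z ord0 0.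
have q02 : `|q0| <= 2.
  by apply: le_trans (ler_normB _ _) _; rewrite normrN1; have := z1 ord0; clear; lra.
have e4 r : `|\sum_(k < m) H r (lift ord0 k) * q k + H r ord0 * q0| <= 6 * 100^-1 * w.
  have -> : \sum_(k < m) H r (lift ord0 k) * q k + H r ord0 * q0 =
      (H *m ones + v - H *m z) r 0 - (2 * H r ord0 + v r 0).
    rewrite c3 c1 c2.
    have -> : \sum_(k < m) H r (lift ord0 k) * q k = \sum_(k < m) H r (lift ord0 k)
        - \sum_(k < m) H r (lift ord0 k) * z (lift ord0 k) 0.
      by rewrite -sumrB; apply: eq_bigr => i _; rewrite /q; ring.
    by rewrite /q0; ring.
  apply: le_trans (ler_normB _ _) _; have := e3 r; rewrite [n%:R * (d * w)]mulrA nd.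
  have dw : d * w <= 100^-1 * w by rewrite ler_wpM2r// ltW.
  have := e2 r; move: dw; clear; lra.
pose Q := \sum_(k < m) `|q k|.
have Q0 : 0 <= Q by apply: sumr_ge0.
have dQ r : `|\sum_(k < m) (H r (lift ord0 k) - (r == k.+1 :> nat)%:R) * q k| <= d * Q.
  apply: le_trans (ler_norm_sum _ _ _) _; rewrite /Q mulr_sumr.
  by apply: ler_sum => k _; rewrite normrM; apply: ler_wpM2r.
(* Row [k + 1] isolates [q k], as column [k + 1] is close to a basis vector. *)
have qk (k : 'I_m) : `|q k| <= 6 * 100^-1 * w + d * Q + 2 * (d * w).
  have kn : (k.+1 < n)%N by apply: leq_ltn_trans mn; exact: ltn_ord.
  pose r : 'I_n := Ordinal kn.
  have rq : \sum_(k < m) ((r == k.+1 :> nat)%:R * q k) = q k.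
    rewrite (bigD1 k)//= eqxx mul1r big1 ?addr0// => i ik.
    by rewrite eqSS (inj_eq val_inj) eq_sym (negPf ik) mul0r.
  have -> : q k = (\sum_(k < m) H r (lift ord0 k) * q k + H r ord0 * q0)
     - (\sum_(k < m) (H r (lift ord0 k) - (r == k.+1 :> nat)%:R) * q k) - H r ord0 * q0.
    rewrite -[LHS]rq.
    have -> : \sum_(k < m) (H r (lift ord0 k) - (r == k.+1 :> nat)%:R) * q k =
      \sum_(k < m) H r (lift ord0 k) * q k - \sum_(k < m) ((r == k.+1 :> nat)%:R * q k).
      by rewrite -sumrB; apply: eq_bigr => i _; ring.
    by ring.
  apply: le_trans (ler_normB _ _) _; apply: lerD.
    by apply: le_trans (ler_normB _ _) _; apply: lerD; [exact: e4|exact: dQ].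
  rewrite normrM mulrC; apply: ler_pM => //.
  by have := H0 r; rewrite /= mul0r subr0.
(* Summing the bounds gives [Q] on both sides; as [m d <= 1 / 100], it can be absorbed. *)
have QU : d * Q <= 100^-1 * (8 * 100^-1 * w + d * Q).
  have Qm : Q <= m%:R * (8 * 100^-1 * w + d * Q).
    apply: (@le_trans _ _ (\sum_(k < m) (8 * 100^-1 * w + d * Q))).
      apply: ler_sum => k _; apply: le_trans (qk k) _.
      have : d * w <= 100^-1 * w by rewrite ler_wpM2r// ltW.
      by clear; lra.
    by rewrite sumr_const card_ord -[leLHS]mulr_natl.
  apply: (@le_trans _ _ (d * (m%:R * (8 * 100^-1 * w + d * Q)))).
    by apply: ler_wpM2l => //; exact: ltW.
  rewrite mulrA [d * _]mulrC; apply: ler_wpM2r => //.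
  by rewrite addr_ge0 ?mulr_ge0// ?invr_ge0// ltW.
have n0 : (0 < n)%N by apply: leq_ltn_trans mn.
pose r0 : 'I_n := Ordinal n0.
(* Row [0] isolates [w * q0]: the other columns nearly vanish there. *)
have wq0 : `|w * q0| <= 9 * 100^-1 * w.
  have -> : w * q0 = (\sum_(k < m) H r0 (lift ord0 k) * q k + H r0 ord0 * q0)
     - (\sum_(k < m) (H r0 (lift ord0 k) - (r0 == k.+1 :> nat)%:R) * q k)
     - (H r0 ord0 - (r0 == 0 :> nat)%:R * w) * q0.
    have -> : \sum_(k < m) (H r0 (lift ord0 k) - (r0 == k.+1 :> nat)%:R) * q k =
      \sum_(k < m) H r0 (lift ord0 k) * q k.
      by apply: eq_bigr => i _; rewrite subr0.
    have -> : (r0 == 0 :> nat)%:R = 1 :> R by [].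
    by ring.
  apply: le_trans (ler_normB _ _) _.
  have h1 : `|(H r0 ord0 - (r0 == 0 :> nat)%:R * w) * q0| <= d * w * 2.
    by rewrite normrM; apply: ler_pM.
  have h2 := ler_normB (\sum_(k < m) H r0 (lift ord0 k) * q k + H r0 ord0 * q0)
     (\sum_(k < m) (H r0 (lift ord0 k) - (r0 == k.+1 :> nat)%:R) * q k).
  have h3 := e4 r0; have h4 := dQ r0.
  have h5 : d * w <= 100^-1 * w by rewrite ler_wpM2r// ltW.
  move: h1 h2 h3 h4 h5 QU w0; clear; lra.
move: wq0; rewrite normrM (ger0_norm (ltW w0)) mulrC ler_pM2r// ler_norml /q0.
by clear; lra.
Qed.

(** * Gaussian probabilities *)

Local Open Scope classical_set_scope.
Local Open Scope ring_scope.

Lemma measurable_normal_pdfE {R : realType} (s : R) (A : set R) :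
  measurable_fun A (EFin \o normal_pdf 0 s).
Proof.
by apply/measurable_EFinP; apply: measurable_funTS; exact: measurable_normal_pdf.
Qed.

Lemma normal_prob_itv_le {R : realType} (s a b : R) : s != 0 -> a <= b ->
  (normal_prob 0 s `[a, b] <= (normal_peak s * (b - a))%:E)%E.
Proof.
move=> s0 ab; rewrite /normal_prob.
apply: (@le_trans _ _ (\int[lebesgue_measure]_(x in `[a, b]) cst (normal_peak s)%:E x)%E).
  apply: ge0_le_integral => //.
  - by move=> x _; rewrite lee_fin normal_pdf_ge0.
  - exact: measurable_normal_pdfE.
  - by move=> x _; rewrite lee_fin normal_pdf_ub.
rewrite integral_cst//= lebesgue_measure_itv/= lte_fin.
case: ltP => h; first by rewrite -EFinB -EFinM.
by rewrite mule0 lee_fin mulr_ge0 ?normal_peak_ge0 ?subr_ge0.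
Qed.

Lemma normal_prob_itv_ge {R : realType} (s a b M : R) : s != 0 -> a <= b ->
  {in `[a, b], forall x, x ^+ 2 <= M} ->
  ((normal_peak s * expR (- M / (s ^+ 2 *+ 2)) * (b - a))%:E <= normal_prob 0 s `[a, b])%E.
Proof.
move=> s0 ab xM; rewrite /normal_prob.
pose c := normal_peak s * expR (- M / (s ^+ 2 *+ 2)).
apply: (@le_trans _ _ (\int[lebesgue_measure]_(x in `[a, b]) cst c%:E x)%E).
  rewrite integral_cst//= lebesgue_measure_itv/= lte_fin.
  case: ltP => h; first by rewrite -EFinB -EFinM.
  have -> : a = b by apply/eqP; rewrite eq_le ab h.
  by rewrite subrr mulr0 mule0.
apply: ge0_le_integral => //.
- by move=> x _; rewrite lee_fin mulr_ge0 ?normal_peak_ge0 ?expR_ge0.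
- exact: measurable_normal_pdfE.
- move=> x xab; rewrite lee_fin normal_pdfE//= /normal_fun subr0.
  rewrite ler_wpM2l ?normal_peak_ge0// ler_expR ler_wpM2r ?invr_ge0 ?mulrn_wge0 ?sqr_ge0//.
  by rewrite lerN2; apply: xM.
Qed.

(* Outside [[-M, M]] the density is at most [2 exp (- M^2 / (4 s^2))] times the one
   with doubled variance. *)
Lemma normal_prob_tail {R : realType} (s M : R) : s != 0 -> 0 <= M ->
  (normal_prob 0 s (~` `[(- M)%R, M]) <= (2 * expR (- (M ^+ 2 / (4 * s ^+ 2))))%:E)%E.
Proof.
move=> s0 M0; rewrite /normal_prob.
have s2 : 0 < s ^+ 2 by rewrite lt_neqAle eq_sym sqrf_eq0 s0 sqr_ge0.
pose s' := Num.sqrt 2 * s.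
have s'E : s' ^+ 2 = 2 * s ^+ 2 by rewrite exprMn sqr_sqrtr.
have s'0 : s' != 0 by rewrite mulf_neq0// sqrtr_eq0 -ltNge.
have peak : normal_peak s <= 2 * normal_peak s'.
  rewrite /normal_peak s'E.
  have -> : 2 * s ^+ 2 * pi *+ 2 = 2 * (s ^+ 2 * pi *+ 2) by ring.
  rewrite [Num.sqrt (2 * _)]sqrtrM// [(_ * Num.sqrt _)^-1]invfM.
  have q0 : 0 < Num.sqrt 2 :> R by rewrite sqrtr_gt0.
  rewrite mulrA ler_peMl ?invr_ge0 ?sqrtr_ge0// ler_pdivlMr// mul1r.
  by rewrite -(@ler_pXn2r _ 2)// ?nnegrE ?ltW// sqr_sqrtr//; lra.
pose e := expR (- (M ^+ 2 / (4 * s ^+ 2))).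
have mT : measurable (~` `[(- M)%R, M] : set R) by apply: measurableC.
have e0 : 0 <= 2 * e by rewrite mulr_ge0 ?expR_ge0.
apply: (@le_trans _ _ (\int[lebesgue_measure]_(x in ~` `[(- M)%R, M])
    ((2 * e)%:E * (normal_pdf 0 s' x)%:E))%E).
  apply: ge0_le_integral => //.
  - by move=> x _; rewrite lee_fin normal_pdf_ge0.
  - exact: measurable_normal_pdfE.
  - apply: measurable_funeM; exact: measurable_normal_pdfE.
  - move=> x /= xM; rewrite -EFinM lee_fin !normal_pdfE//= /normal_fun !subr0 s'E.
    have M2 : M ^+ 2 <= x ^+ 2.
      have : M < `|x|.
        by rewrite ltNge; apply/negP; rewrite ler_norml => h; apply: xM; rewrite /= in_itv.
      move=> h; rewrite -(real_normK (num_real x)); apply: lerXn2r; rewrite ?nnegrE//.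
      exact: ltW.
    have -> : - x ^+ 2 / (s ^+ 2 *+ 2) =
        - (x ^+ 2 / (4 * s ^+ 2)) + - x ^+ 2 / ((2 * s ^+ 2) *+ 2).
      by field.
    rewrite expRD mulrA; have -> : 2 * e * (normal_peak s' * expR (- x ^+ 2 / (2 * s ^+ 2 *+ 2)))
      = 2 * normal_peak s' * e * expR (- x ^+ 2 / (2 * s ^+ 2 *+ 2)) by ring.
    apply: ler_wpM2r; first exact: expR_ge0.
    apply: ler_pM => //; rewrite ?normal_peak_ge0 ?expR_ge0//.
    by rewrite ler_expR lerN2 ler_wpM2r// invr_ge0 mulr_ge0 ?sqr_ge0.
rewrite ge0_integralZl_EFin//; first last.
- exact: measurable_normal_pdfE.
- by move=> x _; rewrite lee_fin normal_pdf_ge0.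
rewrite -[leRHS]mule1; apply: lee_wpmul2l; first by rewrite lee_fin.
rewrite -(integral_normal_pdf 0 s'); apply: ge0_subset_integral => //.
- exact: measurable_normal_pdfE.
- by move=> x _; rewrite lee_fin normal_pdf_ge0.
Qed.

Lemma normal_probT {R : realType} (s : R) : normal_prob 0 s setT = 1%E.
Proof. exact: integral_normal_pdf. Qed.

Lemma normal_prob_ge0 {R : realType} (s : R) A : (0 <= normal_prob 0 s A)%E.
Proof. by apply: integral_ge0 => x _; rewrite lee_fin normal_pdf_ge0. Qed.

Lemma le_prod_EFin {R : realType} (I : finType) (F : I -> \bar R) (u : I -> R) :
  (forall i, (0 <= F i)%E) -> (forall i, (F i <= (u i)%:E)%E) ->
  (\prod_i F i <= (\prod_i u i)%:E)%E.
Proof.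
move=> F0 Fu; rewrite -prodEFin.
suff [] : (0 <= \prod_i F i)%E /\ (\prod_i F i <= \prod_i (u i)%:E)%E by [].
elim/big_rec2: _ => [|i x y _ [y0 yx]]; first by split.
by split; [exact: mule_ge0|exact: lee_pmul].
Qed.

Lemma prod_EFin_le {R : realType} (I : finType) (F : I -> \bar R) (u : I -> R) :
  (forall i, 0 <= u i) -> (forall i, ((u i)%:E <= F i)%E) ->
  ((\prod_i u i)%:E <= \prod_i F i)%E.
Proof.
move=> u0 Fu; rewrite -prodEFin.
suff [] : (0 <= \prod_i (u i)%:E)%E /\ (\prod_i (u i)%:E <= \prod_i F i)%E by [].
elim/big_rec2: _ => [|i x y _ [y0 yx]]; first by split.
by split; [apply: mule_ge0 => //; rewrite lee_fin|apply: lee_pmul => //; rewrite lee_fin].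
Qed.

Definition sign_vec {R : realType} {m} (e : {ffun 'I_m -> bool}) : 'cV[R]_m :=
  \col_j (-1) ^+ e j.

Lemma sign_vec_pm1 {R : realType} m (e : {ffun 'I_m -> bool}) : pm1vec (sign_vec (R := R) e).
Proof. by move=> j; rewrite mxE; case: (e j); [right|left]. Qed.

Lemma pm1_sign_vec {R : realType} m (t : 'cV[R]_m) : pm1vec t -> exists e, t = sign_vec e.
Proof.
move=> pt; exists [ffun j => t j 0 == -1]; apply/colP => j; rewrite mxE ffunE.
have h : ((1 : R) == -1) = false by apply/eqP; lra.
by case: (pt j) => ->; rewrite ?eqxx ?h.
Qed.

Lemma sign_vec_inj {R : realType} m : injective (@sign_vec R m).
Proof.
move=> e e' /colP ee'; apply/ffunP => j; have := ee' j; rewrite !mxE.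
by case: (e j); case: (e' j) => //=; rewrite ?expr0 ?expr1 => ?; exfalso; lra.
Qed.

Lemma measure_le_cover {d} {T : measurableType d} {R : realType} (P : probability T R)
    (I : eqType) (r : seq I) (A : I -> set T) (c : I -> R) (X : set T) :
  measurable X -> (forall i, measurable (A i)) ->
  (forall i, i \in r -> (P (A i) <= (c i)%:E)%E) ->
  (forall x, X x -> exists2 i, i \in r & A i x) ->
  (P X <= (\sum_(i <- r) c i)%:E)%E.
Proof.
elim: r X => [|i r IH] X mX mA Ac XA.
  rewrite big_nil (_ : X = set0) ?measure0//.
  by apply/seteqP; split => x // /XA[].
rewrite big_cons EFinD.
rewrite -[X in P X](setUIDK X (A i)).
have mXA : measurable (X `&` A i) by exact: measurableI.
have mXD : measurable (X `\` A i) by exact: measurableD.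
apply: le_trans (measureU2 P mXA mXD) _; apply: leeD.
  apply: le_trans (Ac i (mem_head _ _)).
  by apply: le_measure; rewrite ?inE//; exact: subIsetr.
apply: IH => // [j jr|x [/XA[j]]]; first by apply: Ac; rewrite inE jr orbT.
by rewrite inE => /orP[/eqP ->|jr] // Aj _; exists j.
Qed.

(** * Rectangle probabilities in the model *)

Section Model.
Context {d : measure_display} {T : measurableType d} {R : realType}.
Context (P : probability T R) (n m : nat) (sigma vsd : R).
Context (H : T -> 'M[R]_(n, m)) (v : T -> 'cV[R]_n) (s : T -> 'cV[R]_m).
Context (law : model_law P sigma vsd H v s).

Definition rect (A : 'I_n -> 'I_m -> set R) (B : 'I_n -> set R) (t : 'cV[R]_m) : set T :=
  [set x | (forall i j, H x i j \in A i j) /\ (forall i, v x i 0 \in B i) /\ s x = t].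

Lemma measurable_rect A B t : (forall i j, measurable (A i j)) ->
  (forall i, measurable (B i)) -> measurable (rect A B t).
Proof.
case: law => mH [mv [ms _]] mA mB.
rewrite (_ : rect A B t =
  (\bigcap_(p in [set: 'I_n * 'I_m]) ((fun x => H x p.1 p.2) @^-1` A p.1 p.2))
  `&` (\bigcap_(i in [set: 'I_n]) ((fun x => v x i 0) @^-1` B i)) `&` [set x | s x = t]).
  apply: measurableI => //; apply: measurableI.
    apply: fin_bigcap_measurable => [|[i j] _]; first exact: finite_finset.
    by rewrite -[X in measurable X]setTI; exact: mH.
  apply: fin_bigcap_measurable => [|i _]; first exact: finite_finset.
  by rewrite -[X in measurable X]setTI; exact: mv.
apply/seteqP; split => x /=.
  move=> [h1 [h2 h3]]; split=> //; split=> [[i j] _|i _]; rewrite /= -in_setE//.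
move=> [[h1 h2] h3]; split; last split => // i; rewrite ?in_setE.
  by move=> i j; rewrite in_setE; exact: (h1 (i, j)).
exact: h2.
Qed.

Lemma rect_le A B t (a : 'I_n -> 'I_m -> R) (b : 'I_n -> R) :
  (forall i j, measurable (A i j)) -> (forall i, measurable (B i)) ->
  (forall i j, (normal_prob 0 sigma (A i j) <= (a i j)%:E)%E) ->
  (forall i, (normal_prob 0 vsd (B i) <= (b i)%:E)%E) ->
  (P (rect A B t) <= ((\prod_i \prod_j a i j) * \prod_i b i)%:E)%E.
Proof.
case: law => _ [_ [_ lawE]] mA mB Aa Bb; rewrite lawE//.
have Ha0 i : (0 <= \prod_j normal_prob 0 sigma (A i j))%E.
  by apply: prode_ge0 => j _; exact: normal_prob_ge0.
have h1 : (\prod_i \prod_j normal_prob 0 sigma (A i j) <= (\prod_i \prod_j a i j)%:E)%E.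
  by apply: le_prod_EFin => // i; apply: le_prod_EFin => // j; exact: normal_prob_ge0.
have h2 : (\prod_i normal_prob 0 vsd (B i) <= (\prod_i b i)%:E)%E.
  by apply: le_prod_EFin => // i; exact: normal_prob_ge0.
have h0 : (0 <= \prod_i normal_prob 0 vsd (B i))%E.
  by apply: prode_ge0 => j _; exact: normal_prob_ge0.
have h0' : (0 <= \prod_i \prod_j normal_prob 0 sigma (A i j))%E by exact: prode_ge0.
rewrite EFinM -[leRHS]mule1; apply: lee_pmul.
- exact: mule_ge0.
- by case: ifP => // _; rewrite lee_fin invr_ge0 exprn_ge0.
- exact: lee_pmul.
- by case: ifP => // _; rewrite lee_fin invf_le1 ?exprn_gt0// exprn_ege1// ler1n.
Qed.

Lemma rect_ge A B t (a : 'I_n -> 'I_m -> R) (b : 'I_n -> R) :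
  pm1vec t -> (forall i j, measurable (A i j)) -> (forall i, measurable (B i)) ->
  (forall i j, 0 <= a i j) -> (forall i, 0 <= b i) ->
  (forall i j, ((a i j)%:E <= normal_prob 0 sigma (A i j))%E) ->
  (forall i, ((b i)%:E <= normal_prob 0 vsd (B i))%E) ->
  (((\prod_i \prod_j a i j) * (\prod_i b i) * 2 ^- m)%:E <= P (rect A B t))%E.
Proof.
case: law => _ [_ [_ lawE]] pt mA mB a0 b0 Aa Bb; rewrite lawE//.
have p0 : 0 <= \prod_i \prod_j a i j by apply: prodr_ge0 => i _; exact: prodr_ge0.
have q0 : 0 <= \prod_i b i by exact: prodr_ge0.
rewrite asboolT// EFinM; apply: lee_pmul => //; rewrite ?lee_fin ?mulr_ge0 ?invr_ge0 ?exprn_ge0//.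
rewrite EFinM; apply: lee_pmul => //; rewrite ?lee_fin//.
  apply: prod_EFin_le => i; first exact: prodr_ge0.
  exact: prod_EFin_le.
exact: prod_EFin_le.
Qed.

(** The [2 ^ m] disjoint events fixing [s] to a sign vector each have probability [2 ^- m], so they
    exhaust the space up to a null set. *)
Lemma pm1_ae : exists2 E, measurable E /\ P E = 0%E & forall x, ~ E x -> pm1vec (s x).
Proof.
case: law => _ [_ [ms lawE]].
pose S (e : {ffun 'I_m -> bool}) : set T := [set x | s x = sign_vec e].
have mS e : measurable (S e) by exact: ms.
have PS e : P (S e) = (2 ^- m)%:E.
  have := lawE (fun _ _ => setT) (fun=> setT) (sign_vec e) (fun _ _ => measurableT) (fun=> measurableT).
  rewrite (_ : [set x | _] = S e); last first.
    apply/seteqP; split => x /=; first by move=> [_ []].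
    by move=> sx; split=> [i j|]; [|split=> // i]; rewrite in_setE.
  move=> ->; rewrite asboolT; last exact: sign_vec_pm1.
  rewrite [X in (X * _ * _)%E]big1 => [|i _]; last by rewrite big1// => j _; exact: normal_probT.
  by rewrite [X in (_ * X * _)%E]big1 ?mul1e// => i _; exact: normal_probT.
pose U := \bigcup_(e in [set: {ffun 'I_m -> bool}]) S e.
have mU : measurable U.
  by apply: fin_bigcup_measurable => // ; exact: finite_finset.
have PU : P U = 1%E.
  rewrite /U measure_fin_bigcup//; [|exact: finite_finset|]; last first.
    by move=> e e' _ _ [x [/= h1 h2]]; apply: (@sign_vec_inj R m); rewrite -h1 -h2.
  rewrite (_ : [set: {ffun 'I_m -> bool}] = [set` enum {ffun 'I_m -> bool}]); last first.
    by apply/seteqP; split => e //= _; rewrite mem_enum.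
  rewrite -fsbig_seq ?enum_uniq// big_enum/=.
  under eq_bigr do rewrite PS.
  rewrite sumEFin sumr_const card_ffun card_bool card_ord -[X in X%:E]mulr_natl natrX.
  by rewrite mulfV// expf_neq0.
exists (~` U); first by split; [exact: measurableC|rewrite probability_setC// PU subee].
move=> x /= /contrapT[e _ /= ->]; exact: sign_vec_pm1.
Qed.
End Model.

(** A union bound: unless an entry of [H] exceeds [L] or one of [v] exceeds [L * w], the channel
    lies in a bad cell for some signs and some pivot order. *)
Lemma misled_prob_le {d} {T : measurableType d} {R : realType} (P : probability T R)
    (n m : nat) (sigma w : R) (H : T -> 'M[R]_(n, m.+1)) (v : T -> 'cV[R]_n)
    (s : T -> 'cV[R]_m.+1) (N L : nat) (X : set T) :
  model_law P sigma w H v s -> sigma != 0 -> 0 < w -> w <= N%:R^-1 ->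
  (0 < N)%N -> (0 < L)%N -> (14 * N <= 2 ^ L)%N ->
  14 * m.+1%:R <= N%:R * gap (R := R) m ^+ 2 ->
  measurable X -> (forall x, X x -> pm1vec (s x) -> misled (H x) (v x) (s x)) ->
  (P X <= (2 ^+ m.+1 * (n%:R * m.+1%:R * (2 * expR (- (L%:R ^+ 2 / (4 * sigma ^+ 2))))
     + n%:R * (2 * expR (- (L%:R ^+ 2 / 4)))
     + (m.+1)`!%:R * #|bad_cells (R := R) n m N L|%:R
       * (normal_peak sigma / N%:R) ^+ (m.+1 * n)))%:E)%E.
Proof.
move=> law sigma0 w0 wN N0 L0 NL Ngap mX XM.
have [E [mE PE] Epm] := pm1_ae P n m.+1 sigma w H v s law.
have NR : 0 < N%:R :> R by rewrite ltr0n.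
pose S := {ffun 'I_m.+1 -> bool}.
pose F := {ffun 'I_n -> {ffun 'I_m.+1 -> 'I_(cellN N L)}}.
(* The covering events: the null set, a large channel entry, a large noise entry, a bad cell. All
   but the first fix [s] to a sign vector, since the law is given on such rectangles. *)
pose I := ((unit + (S * 'I_n * 'I_m.+1)) + ((S * 'I_n) + (S * 'S_m.+1 * F)))%type.
pose t1 : R := 2 * expR (- (L%:R ^+ 2 / (4 * sigma ^+ 2))).
pose t2 : R := 2 * expR (- (L%:R ^+ 2 / 4)).
pose t3 : R := (normal_peak sigma / N%:R) ^+ (m.+1 * n).
pose c (i : I) : R := match i with
  inl (inl _) => 0 | inl (inr _) => t1 | inr (inl _) => t2 | inr (inr _) => t3 end.
pose Q (i : I) := if i is inr (inr (_, f)) then f \in bad_cells (R := R) n m N L else true.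
pose out : set R := ~` `[(- L%:R)%R, L%:R].
pose outw : set R := ~` `[(- (L%:R * w))%R, L%:R * w].
(* Cell [j] of [f] concerns column [p j] multiplied by its sign, hence the inverse permutation and
   the reflected interval. *)
pose box (e : S) (p : 'S_m.+1) (f : F) (i : 'I_n) (j : 'I_m.+1) : set R :=
  let g : R := gridpt N L (f i (p^-1%g j)) in
  if e j then `[- (g + N%:R^-1), - g]%classic else `[g, g + N%:R^-1]%classic.
pose A (i : I) : set T := match i with
  | inl (inl _) => E
  | inl (inr (e, r, j)) => rect n m.+1 H v s
      (fun r' j' => if (r' == r) && (j' == j) then out else setT) (fun=> setT) (sign_vec e)
  | inr (inl (e, r)) => rect n m.+1 H v s
      (fun _ _ => setT) (fun r' => if r' == r then outw else setT) (sign_vec e)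
  | inr (inr (e, p, f)) => rect n m.+1 H v s (box e p f) (fun=> setT) (sign_vec e)
  end.
have mout : measurable out by apply: measurableC.
have moutw : measurable outw by apply: measurableC.
have mbox e p f i j : measurable (box e p f i j) by rewrite /box; case: ifP.
have mA i : measurable (A i).
  case: i => [[_|[[e r] j]]|[[e r]|[[e p] f]]] //=;
    apply: (measurable_rect P _ _ sigma w _ _ _ law) => // *; by case: ifP.
have Ac i : (P (A i) <= (c i)%:E)%E.
  case: i => [[_|[[e r] j]]|[[e r]|[[e p] f]]] /=; first by rewrite PE.
  - have -> : t1 = (\prod_(i < n) \prod_(k < m.+1) (if (i == r) && (k == j) then t1 else 1))
          * \prod_(i < n) 1.
      rewrite [\prod_(i < n) 1]big1// mulr1 (bigD1 r)//= (bigD1 j)//= !eqxx/=.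
      rewrite big1 => [|k /negPf ->]//; rewrite big1 ?mulr1// => i /negPf ->.
      by rewrite big1.
    apply: (rect_le P _ _ sigma w _ _ _ law) => //.
    + by move=> i k; case: ifP.
    + move=> i k; case: ifP => _; last by rewrite normal_probT.
      by apply: normal_prob_tail.
    + by move=> i; rewrite normal_probT.
  - have -> : t2 = (\prod_(i < n) \prod_(k < m.+1) 1)
          * \prod_(i < n) (if i == r then t2 else 1).
      rewrite big1 => [|i _]; last by rewrite big1.
      rewrite mul1r (bigD1 r)//= eqxx big1 ?mulr1// => i /negPf ->//.
    apply: (rect_le P _ _ sigma w _ _ _ law) => //.
    + by move=> i; case: ifP.
    + by move=> i k; rewrite normal_probT.
    + move=> i; case: ifP => _; last by rewrite normal_probT.
      rewrite /t2; have -> : L%:R ^+ 2 / 4 = (L%:R * w) ^+ 2 / (4 * w ^+ 2).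
        by field; rewrite gt_eqF.
      by apply: normal_prob_tail; rewrite ?gt_eqF// mulr_ge0// ltW.
  - have -> : t3 = (\prod_(i < n) \prod_(k < m.+1) (normal_peak sigma / N%:R))
          * \prod_(i < n) 1.
      rewrite [\prod_(i < n) 1]big1// mulr1.
      by under eq_bigr do rewrite prodr_const card_ord; rewrite prodr_const card_ord -exprM.
    apply: (rect_le P _ _ sigma w _ _ _ law) => //.
    + by move=> i j; exact: mbox.
    + move=> i j; rewrite /box; set g := gridpt _ _ _.
      have gN : g <= g + N%:R^-1 by rewrite lerDl invr_ge0.
      case: ifP => _.
        have gN' : - (g + N%:R^-1) <= - g by rewrite lerN2.
        have := normal_prob_itv_le sigma _ _ sigma0 gN'.
        by have -> : - g - - (g + N%:R^-1) = N%:R^-1 by ring.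
      have := normal_prob_itv_le sigma _ _ sigma0 gN.
      by have -> : g + N%:R^-1 - g = N%:R^-1 by ring.
    + by move=> i; rewrite normal_probT.
have XA x : X x -> exists2 i, i \in enum Q & A i x.
  move=> Xx; have [Ex|Ex] := pselect (E x).
    by exists (inl (inl tt)); rewrite ?mem_enum.
  have pms := Epm _ Ex; have [e es] := pm1_sign_vec _ _ pms.
  have [HL|] := pselect (forall r j, `|H x r j| <= L%:R); last first.
    move=> /existsNP[r /existsNP[j HL]].
    exists (inl (inr (e, r, j))); first by rewrite mem_enum.
    split=> [i k|]; last by split=> // i; rewrite in_setE.
    rewrite in_setE; case: ifP => // /andP[/eqP -> /eqP ->].
    by rewrite /out /= in_itv/= -ler_norml.
  have [vL|] := pselect (forall r, `|v x r 0| <= L%:R * w); last first.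
    move=> /existsNP[r vL].
    exists (inr (inl (e, r))); first by rewrite mem_enum.
    split=> [i k|]; first by rewrite in_setE.
    split=> // i; rewrite in_setE; case: ifP => // /eqP ->.
    by rewrite /outw /= in_itv/= -ler_norml.
  have vL' r : `|v x r 0| <= L%:R / N%:R.
    by apply: le_trans (vL r) _; apply: ler_wpM2l.
  have [p [f fB fP]] := misled_bad_cells _ _ _ _ _ _ _ N0 L0 NL Ngap pms HL vL' (XM _ Xx pms).
  exists (inr (inr (e, p, f))); first by rewrite mem_enum.
  split=> [i j|]; last by split=> // i; rewrite in_setE.
  rewrite in_setE /box; have := fP i (p^-1%g j); rewrite permKV es mxE.
  by case: (e j) => /=; rewrite in_itv/= ?expr1 ?expr0 ?mulN1r ?mul1r// lerNl lerNr andbC.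
apply: le_trans (measure_le_cover P _ (enum Q) A c X mX mA (fun i _ => Ac i) XA) _.
rewrite lee_fin big_enum_cond/= !big_sumType/= big1// add0r.
have -> : \sum_(i : S * 'S_m.+1 * F | (inr (inr i) \in Q) && true) t3
   = t3 *+ (2 ^ m.+1 * (m.+1)`! * #|bad_cells (R := R) n m N L|).
  rewrite (eq_bigl (mem (finset.setX (finset.setTfor (S * 'S_m.+1)%type) (bad_cells (R := R) n m N L)))); last first.
    by move=> [[e p] f]; rewrite andbT /= finset.in_setX finset.in_setT.
  by rewrite sumr_const cardsX cardsT card_prod card_Sn card_ffun card_bool card_ord.
rewrite !sumr_const !card_prod card_ffun card_bool !card_ord -/t1 -/t2 -/t3.
rewrite -[t1 *+ _]mulr_natl -[t2 *+ _]mulr_natl -[t3 *+ _]mulr_natl !natrM !natrX.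
by rewrite le_eqVlt; apply/orP; left; apply/eqP; ring.
Qed.

(** The event of [first_entry_lost] is a rectangle. Each of the [n] entries of the first column
    costs a factor [w]; the noise intervals are proportional to its standard deviation [w] and, like
    the other channel entries, cost only constants. *)
Lemma lost_prob_ge {d} {T : measurableType d} {R : realType} (P : probability T R)
    (n m : nat) (sigma : R) (H : T -> 'M[R]_(n, m.+1)) (s : T -> 'cV[R]_m.+1) :
  sigma != 0 -> (m < n)%N ->
  exists2 c : R, 0 < c & forall (w : R) (v : T -> 'cV[R]_n) (X : set T), 0 < w -> w <= 1 ->
    model_law P sigma w H v s -> measurable X ->
    (forall x, (forall z : 'cV[R]_m.+1, (forall j, `|z j 0| <= 1) ->
        sqnorm (H x *m s x + v x - H x *m z)
          <= sqnorm (H x *m s x + v x - H x *m flip_first m) -> z ord0 0 < 0) ->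
      s x = const_mx 1 -> X x) ->
    ((c * w ^+ n)%:E <= P X)%E.
Proof.
move=> sigma0 mn.
pose h : R := (100 * n%:R)^-1.
have n1 : 1 <= n%:R :> R by rewrite ler1n; apply: leq_ltn_trans mn.
have h0 : 0 < h by rewrite invr_gt0; lra.
have h1 : h <= 1 by rewrite invf_le1 ?mulr_gt0//; lra.
(* The exponents come from the bounds [x ^ 2 <= 4] on the channel intervals and [x ^ 2 <= 9 w ^ 2]
   on the noise intervals. *)
pose a0 : R := normal_peak sigma * expR (- 4 / (sigma ^+ 2 *+ 2)) * (2 * h).
have a0_gt0 : 0 < a0 by rewrite !mulr_gt0 ?expR_gt0 ?normal_peak_gt0.
pose b0 : R := normal_peak 1 * expR (- 9 / 2) * (2 * h).
have b0_gt0 : 0 < b0 by rewrite !mulr_gt0 ?expR_gt0 ?normal_peak_gt0// oner_neq0.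
exists (a0 ^+ (m.+1 * n) * b0 ^+ n * 2 ^- m.+1).
  by rewrite !mulr_gt0 ?exprn_gt0 ?invr_gt0 ?exprn_gt0.
move=> w v X w0 w1 law mX XP.
pose sc (j : 'I_m.+1) : R := if j == ord0 then w else 1.
have sc0 j : 0 < sc j by rewrite /sc; case: ifP.
have sc1 j : sc j <= 1 by rewrite /sc; case: ifP.
pose ctr (i : 'I_n) (j : 'I_m.+1) : R := (i == j :> nat)%:R * sc j.
pose A (i : 'I_n) (j : 'I_m.+1) : set R := `[ctr i j - h * sc j, ctr i j + h * sc j]%classic.
pose cv (i : 'I_n) : R := - 2 * ((i == 0 :> nat)%:R * w).
pose B (i : 'I_n) : set R := `[cv i - h * w, cv i + h * w]%classic.
have hw : 0 < h * w by rewrite mulr_gt0.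
have peakw : normal_peak w * w = normal_peak 1.
  rewrite /normal_peak expr1n mul1r -mulrnAr sqrtrM ?sqr_ge0// sqrtr_sqr.
  by rewrite gtr0_norm// invfM mulrAC mulVf ?mul1r// gt_eqF.
have itvA : forall i j, ((a0 * sc j)%:E <= normal_prob 0 sigma (A i j))%E.
  move=> i j; have hs : 0 < h * sc j by rewrite mulr_gt0.
  have le1 : ctr i j - h * sc j <= ctr i j + h * sc j by lra.
  have inA : {in `[ctr i j - h * sc j, ctr i j + h * sc j], forall x, x ^+ 2 <= 4}.
    move=> x; rewrite in_itv/= => /andP[x1 x2].
    have hs1 : h * sc j <= 1 by rewrite -[leRHS]mulr1 ler_pM// ltW.
    have c0 : 0 <= ctr i j <= 1.
      rewrite /ctr; case: eqP => _; rewrite ?mul0r ?mul1r ?lexx ?ler01//.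
      by rewrite ltW// sc1.
    have -> : 4 = 2 ^+ 2 :> R by ring.
    by rewrite -(real_normK (num_real x)) lerXn2r ?nnegrE// ler_norml; lra.
  have := normal_prob_itv_ge sigma _ _ 4 sigma0 le1 inA.
  have -> : ctr i j + h * sc j - (ctr i j - h * sc j) = 2 * h * sc j by ring.
  by rewrite mulrA.
have itvB : forall i, (b0%:E <= normal_prob 0 w (B i))%E.
  move=> i.
  have le1 : cv i - h * w <= cv i + h * w by lra.
  have inB : {in `[cv i - h * w, cv i + h * w], forall x, x ^+ 2 <= 9 * w ^+ 2}.
    move=> x; rewrite in_itv/= => /andP[x1 x2].
    have hw1 : h * w <= w by rewrite ler_piMl// ltW.
    have c0 : - 2 * w <= cv i <= 0.
      by rewrite /cv; case: eqP => _; rewrite ?mul0r ?mul1r ?mulr0 ?lexx ?andbT//; lra.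
    have -> : 9 * w ^+ 2 = (3 * w) ^+ 2 by ring.
    rewrite -(real_normK (num_real x)) lerXn2r ?nnegrE// ?ler_norml; last lra.
    by rewrite mulr_ge0// ltW.
  have := normal_prob_itv_ge w _ _ _ (lt0r_neq0 w0) le1 inB.
  have -> : cv i + h * w - (cv i - h * w) = 2 * h * w by ring.
  have -> : - (9 * w ^+ 2) / (w ^+ 2 *+ 2) = - 9 / 2 by field; rewrite gt_eqF.
  by rewrite /b0 -peakw; congr ((_)%:E <= _)%E; ring.
have mA i j : measurable (A i j) by exact: measurable_itv.
have mB i : measurable (B i) by exact: measurable_itv.
pose ones : 'cV[R]_m.+1 := const_mx 1.
have p1 : pm1vec ones by move=> j; rewrite mxE; left.
have := rect_ge P n m.+1 sigma w H v s law A B _ (fun i j => a0 * sc j) (fun=> b0) p1 mA mB.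
move=> /(_ _ _ itvA itvB) ge.
have : (P (rect n m.+1 H v s A B ones) <= P X)%E.
  apply: le_measure; rewrite ?inE//.
    exact: (measurable_rect P _ _ sigma w _ _ _ law).
  move=> x [HA [vB sx]]; apply: XP => // z z1; rewrite sx.
  apply: (@first_entry_lost R n m mn (H x) (v x) z w w0) => //.
  - move=> r j; have := HA r j; rewrite in_setE /A /= in_itv/= -/h -/(sc j) /ctr => /andP[u1 u2].
    by rewrite ler_norml; apply/andP; split; move: u1 u2; clear; lra.
  - move=> r; have := vB r; rewrite in_setE /B /= in_itv/= -/h /cv => /andP[u1 u2].
    by rewrite ler_norml; apply/andP; split; move: u1 u2; clear; lra.
apply: le_trans; apply: le_trans (ge _ _) => //; last 2 first.
- by move=> i j; rewrite mulr_ge0// ltW.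
- by move=> _; exact: ltW.
have iE : \prod_j (a0 * sc j) = a0 ^+ m.+1 * w.
  have sc_ord0 : sc ord0 = w by rewrite /sc eqxx.
  have sc_lift j : sc (lift ord0 j) = 1 by rewrite /sc eq_sym (negPf (neq_lift _ _)).
  rewrite big_split/= prodr_const card_ord big_ord_recl sc_ord0.
  by rewrite big1 ?mulr1// => j _; exact: sc_lift.
have pE : \prod_(i < n) \prod_j (a0 * sc j) = a0 ^+ (m.+1 * n) * w ^+ n.
  by rewrite prodr_const card_ord iE exprMn -exprM.
rewrite lee_fin pE prodr_const card_ord.
by rewrite le_eqVlt; apply/orP; left; apply/eqP; ring.
Qed.

(** * Error exponents *)

Lemma expR_half_le2 {R : realType} : expR (2^-1) <= 2 :> R.
Proof.
have := expR_ge1Dx (- 2^-1 : R); rewrite expRN => h.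
rewrite -[leLHS]invrK -[leRHS]invrK lef_pV2 ?posrE ?invr_gt0 ?expR_gt0//; lra.
Qed.

(** With [u = ln rho], take [N] near [rho ^ (1/2)] and [L] near [u]. The tails are exponential in
    [- L ^ 2], hence negligible, and the cells contribute [N ^- n] up to a power of [L]. *)
Lemma misled_asymptotics {d} {T : measurableType d} {R : realType} (P : probability T R)
    (n m : nat) (sigma : R) (H : T -> 'M[R]_(n, m.+1)) (s : T -> 'cV[R]_m.+1) :
  sigma != 0 -> (m < n)%N ->
  exists (C u0 : R) (e : nat), 0 < C /\
    forall (u : R) (v : T -> 'cV[R]_n) (X : set T), u0 <= u ->
    model_law P sigma (expR (- (u / 2))) H v s -> measurable X ->
    (forall x, X x -> pm1vec (s x) -> misled (H x) (v x) (s x)) ->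
    (P X <= (C * (u + 27) ^+ e * expR (- (n%:R * (u / 2))))%:E)%E.
Proof.
move=> sigma0 mn.
pose g : R := gap (R := R) m.
have g0 : 0 < g by rewrite invr_gt0 mulr_gt0 ?ltr0n.
have s2 : 0 < sigma ^+ 2 by rewrite lt_neqAle eq_sym sqrf_eq0 sigma0 sqr_ge0.
pose pk := normal_peak sigma ^+ (m.+1 * n).
have pk0 : 0 <= pk by rewrite exprn_ge0// normal_peak_ge0.
pose bc := bad_const (R := R) n m.
have bc0 : 0 <= bc.
  have S0 : 0 <= 8 * slackH (R := R) n m + 14.
    by rewrite /slackH addr_ge0 ?mulr_ge0 ?addr_ge0 ?mulr_ge0.
  by rewrite /bc /bad_const !mulr_ge0 ?exprn_ge0 ?row_const_ge0.
pose e := (m + m.+1 * n)%N.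
pose C : R := 2 ^+ m.+1 * (n%:R * m.+1%:R * 2 + n%:R * 2 + (m.+1)`!%:R * (bc * pk * 2 ^+ n)).
have C0 : 0 <= C.
  have bp0 : 0 <= bc * pk * 2 ^+ n by apply: mulr_ge0; [exact: mulr_ge0|exact: exprn_ge0].
  apply: mulr_ge0; first exact: exprn_ge0.
  by apply: addr_ge0; [apply: addr_ge0|]; apply: mulr_ge0 => //; apply: mulr_ge0.
(* The summands ensure, in turn, the noise tail, the channel tail, the lower bound on [N] (through
   [u <= 4 N]) and [1 <= u]. *)
pose u0 : R := 2 * n%:R + 2 * n%:R * sigma ^+ 2 + 56 * m.+1%:R / g ^+ 2 + 1.
exists (C + 1), u0, e; split; first by lra.
move=> u v X u0u law mX XM.
have n0 : 0 <= n%:R :> R by [].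
have t1 : 0 <= 2 * n%:R * sigma ^+ 2.
  by apply: mulr_ge0; [exact: mulr_ge0|exact: sqr_ge0].
have t2 : 0 <= 56 * m.+1%:R / g ^+ 2.
  by apply: divr_ge0; [exact: mulr_ge0|exact: sqr_ge0].
have u1 : 1 <= u by move: u0u n0 t1 t2; rewrite /u0; clear; lra.
have u_n : 2 * n%:R <= u by move: u0u n0 t1 t2; rewrite /u0; clear; lra.
have u_s : 2 * n%:R * sigma ^+ 2 <= u by move: u0u n0 t1 t2; rewrite /u0; clear; lra.
have u_g : 56 * m.+1%:R / g ^+ 2 <= u by move: u0u n0 t1 t2; rewrite /u0; clear; lra.
pose r : R := expR (u / 2); pose w : R := expR (- (u / 2)).
have r0 : 0 < r by exact: expR_gt0.
have r1 : u / 2 <= r by apply: le_trans (expR_ge1Dx _); rewrite lerDr.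
have r_ge1 : 1 <= r by apply: le_trans (expR_ge1Dx _); rewrite lerDl; move: u1; clear; lra.
have wE : w = r^-1 by rewrite /w expRN.
pose N := Num.truncn r.
have /andP[Nr rN] := truncn_itv (ltW r0); rewrite -/N in Nr rN.
have N0 : (0 < N)%N by rewrite /N truncn_gt0.
have NR : 0 < N%:R :> R by rewrite ltr0n.
have N1 : 1 <= N%:R :> R by rewrite ler1n.
have rN2 : r <= 2 * N%:R by move: rN N1; rewrite -natr1; clear; lra.
have wN : w <= N%:R^-1 by rewrite wE lef_pV2 ?posrE.
have Nw : N%:R^-1 <= 2 * w.
  rewrite wE -[_^-1]mul1r ler_pdivrMr// mulrAC ler_pdivlMr// mul1r.
  exact: rN2.
(* As [14 <= expR 13] and [expR (1/2) <= 2], the condition [14 N <= 2 ^ L] follows from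
   [L >= u + 26]; truncation costs one more. *)
pose L := (Num.truncn u + 27)%N.
have u00 : 0 <= u by move: u1; clear; lra.
have /andP[Lu uL] := truncn_itv u00.
have LE : L%:R = (Num.truncn u)%:R + 27 :> R by rewrite natrD.
have L_le : L%:R <= u + 27 by rewrite LE lerD2r.
have L_ge : u + 26 <= L%:R by rewrite LE; move: uL; rewrite -natr1; clear; lra.
have L0 : (0 < L)%N by rewrite /L addnS.
have L1 : 1 <= L%:R :> R by rewrite ler1n.
have NL : (14 * N <= 2 ^ L)%N.
  rewrite -(ler_nat R) natrX natrM.
  apply: (@le_trans _ _ (expR 13 * r)).
    apply: ler_pM => //; apply: le_trans (expR_ge1Dx _); clear; lra.
  rewrite /r -expRD; apply: (@le_trans _ _ (expR (L%:R * 2^-1))).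
    by rewrite ler_expR; move: L_ge; clear; lra.
  by rewrite expRM_natl; apply: lerXn2r; rewrite ?nnegrE ?expR_ge0// expR_half_le2.
have Ngap : 14 * m.+1%:R <= N%:R * g ^+ 2.
  have g2 : 0 < g ^+ 2 by rewrite exprn_gt0.
  move: u_g; rewrite ler_pdivrMr// => u_g.
  have : u * g ^+ 2 <= 4 * N%:R * g ^+ 2.
    by apply: ler_wpM2r; [exact: ltW|move: r1 rN2; clear; lra].
  by move: u_g; clear; lra.
have w0 : 0 < w by exact: expR_gt0.
apply: le_trans (misled_prob_le P n m sigma w H v s N L X law sigma0 w0 wN N0 L0 NL Ngap mX XM) _.
rewrite lee_fin.
set Z := expR (- (n%:R * (u / 2))).
have Z0 : 0 < Z by exact: expR_gt0.
have ZE : Z = w ^+ n by rewrite /Z /w -expRM_natl mulrN.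
have L2 : u * u <= L%:R ^+ 2.
  by rewrite expr2; apply: ler_pM => //; move: L_ge; clear; lra.
have e1 : expR (- (L%:R ^+ 2 / (4 * sigma ^+ 2))) <= Z.
  rewrite ler_expR lerN2 ler_pdivlMr; last exact: mulr_gt0.
  apply: le_trans L2; have -> : n%:R * (u / 2) * (4 * sigma ^+ 2) = u * (2 * n%:R * sigma ^+ 2).
    by field.
  by apply: ler_wpM2l.
have e2 : expR (- (L%:R ^+ 2 / 4)) <= Z.
  rewrite ler_expR lerN2 ler_pdivlMr//.
  apply: le_trans L2; have -> : n%:R * (u / 2) * 4 = u * (2 * n%:R) by field.
  by apply: ler_wpM2l.
have LeZ : Z <= L%:R ^+ e * Z by rewrite ler_peMl ?exprn_ege1// ltW.
have e3 : #|bad_cells (R := R) n m N L|%:R * (normal_peak sigma / N%:R) ^+ (m.+1 * n)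
    <= bc * pk * 2 ^+ n * (L%:R ^+ e * Z).
  apply: (@le_trans _ _ (bc * L%:R ^+ e * N%:R ^+ (m * n)
       * (normal_peak sigma / N%:R) ^+ (m.+1 * n))).
    apply: ler_wpM2r; first by rewrite exprn_ge0// divr_ge0 ?normal_peak_ge0.
    exact: card_bad_cells.
  have -> : bc * L%:R ^+ e * N%:R ^+ (m * n) * (normal_peak sigma / N%:R) ^+ (m.+1 * n)
     = bc * pk * L%:R ^+ e * N%:R^-1 ^+ n.
    rewrite exprMn -/pk -[m.+1]addn1 mulnDl mul1n [N%:R^-1 ^+ (_ + _)]exprD exprVn.
    by field; rewrite expf_neq0// gt_eqF.
  have -> : bc * pk * 2 ^+ n * (L%:R ^+ e * Z) = bc * pk * L%:R ^+ e * (2 * w) ^+ n.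
    by rewrite ZE exprMn; ring.
  apply: ler_wpM2l; first by apply: mulr_ge0; [exact: mulr_ge0|exact: exprn_ge0].
  by apply: lerXn2r; rewrite ?nnegrE ?invr_ge0// mulr_ge0// ltW.
apply: (@le_trans _ _ (C * (L%:R ^+ e * Z))).
  rewrite /C -[leRHS]mulrA; apply: ler_wpM2l; first exact: exprn_ge0.
  rewrite [leRHS]mulrDl [X in _ <= X + _]mulrDl; apply: lerD; first apply: lerD.
  - rewrite [leLHS]mulrA; apply: ler_wpM2l; last exact: le_trans e1 LeZ.
    by apply: mulr_ge0 => //; apply: mulr_ge0.
  - rewrite [leLHS]mulrA; apply: ler_wpM2l; last exact: le_trans e2 LeZ.
    exact: mulr_ge0.
  - by rewrite -[leLHS]mulrA -[leRHS]mulrA; apply: ler_wpM2l.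
have LZ0 : 0 <= L%:R ^+ e * Z by apply: mulr_ge0; [exact: exprn_ge0|exact: ltW].
apply: (@le_trans _ _ ((C + 1) * (L%:R ^+ e * Z))).
  by apply: ler_wpM2r => //; rewrite lerDl.
rewrite -mulrA; apply: ler_wpM2l; first by rewrite addr_ge0.
apply: ler_wpM2r; first exact: ltW.
by apply: lerXn2r; rewrite ?nnegrE// addr_ge0.
Qed.

Lemma ln_le_sqrt {R : realType} (x : R) : 0 < x -> ln x <= 2 * Num.sqrt x.
Proof.
move=> x0; have s0 : 0 < Num.sqrt x by rewrite sqrtr_gt0.
have -> : ln x = 2 * ln (Num.sqrt x).
  by rewrite -{1}(sqr_sqrtr (ltW x0)) lnXn// mulr_natl.
apply: ler_wpM2l => //; rewrite -{2}(lnK (s0 : Num.sqrt x \is Num.pos)).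
by apply: le_trans (expR_ge1Dx _); rewrite lerDr.
Qed.

(** After taking logarithms, the constants and the power of [ln rho] contribute [O(ln (ln rho))],
    negligible against [ln rho]. *)
Lemma ln_rate_cvg {R : realType} (f : R -> R) (a c C u0 : R) (e : nat) :
  0 < c -> 0 < C ->
  (forall rho, 0 < rho -> u0 <= ln rho ->
    c * expR (- (a * ln rho)) <= f rho
      <= C * (ln rho + 27) ^+ e * expR (- (a * ln rho))) ->
  ln (f rho) / ln rho @[rho --> +oo] --> (- a : R).
Proof.
move=> c0 C0 fP; apply/cvgrPdist_le => eps eps0.
(* Once [k <= Num.sqrt u], the bound [4 e Num.sqrt u] on the logarithmic term is at most
   [eps u / 2]. *)
pose k : R := 8 * e%:R / eps.
have k0 : 0 <= k by rewrite divr_ge0 ?mulr_ge0// ltW.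
pose u1 : R := 27 + `|u0| + `|ln c| / eps + 2 * `|ln C| / eps + k ^+ 2.
have p1 : 0 <= `|ln c| / eps by rewrite divr_ge0// ltW.
have p2 : 0 <= 2 * `|ln C| / eps by rewrite divr_ge0 ?mulr_ge0// ltW.
have p3 : 0 <= k ^+ 2 by exact: sqr_ge0.
have p4 : 0 <= `|u0| by [].
near=> rho.
have rho_ge : expR u1 <= rho by near: rho; apply: nbhs_pinfty_ge; rewrite num_real.
have rho0 : 0 < rho by apply: lt_le_trans rho_ge; exact: expR_gt0.
set u := ln rho.
have uu1 : u1 <= u by rewrite -ler_expR lnK.
have u27 : 27 <= u by move: uu1 p1 p2 p3 p4; rewrite /u1; clear; lra.
have u_u0 : u0 <= u.
  by apply: le_trans (ler_norm u0) _; move: uu1 p1 p2 p3 p4; rewrite /u1; clear; lra.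
have u_c : `|ln c| / eps <= u by move: uu1 p1 p2 p3 p4; rewrite /u1; clear; lra.
have u_C : 2 * `|ln C| / eps <= u by move: uu1 p1 p2 p3 p4; rewrite /u1; clear; lra.
have u_k : k ^+ 2 <= u by move: uu1 p1 p2 p3 p4; rewrite /u1; clear; lra.
have u_gt0 : 0 < u by move: u27; clear; lra.
have /andP[f1 f2] := fP _ rho0 u_u0.
have E0 := expR_gt0 (- (a * u)).
have cE0 : 0 < c * expR (- (a * u)) by rewrite mulr_gt0.
have f0 : 0 < f rho by apply: lt_le_trans f1.
have u270 : 0 < u + 27 by move: u27; clear; lra.
have ln1 : ln c - a * u <= ln (f rho).
  have <- : ln (c * expR (- (a * u))) = ln c - a * u by rewrite lnM ?posrE// expRK.
  by rewrite ler_ln ?posrE.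
have ln2 : ln (f rho) <= ln C + e%:R * ln (u + 27) - a * u.
  have <- : ln (C * (u + 27) ^+ e * expR (- (a * u))) = ln C + e%:R * ln (u + 27) - a * u.
    by rewrite !lnM ?posrE ?mulr_gt0 ?exprn_gt0// expRK lnXn// mulr_natl.
  by rewrite ler_ln ?posrE// !mulr_gt0 ?exprn_gt0.
have ln3 : e%:R * ln (u + 27) <= eps / 2 * u.
  apply: (@le_trans _ _ (e%:R * (4 * Num.sqrt u))).
    apply: ler_wpM2l => //; apply: le_trans (ln_le_sqrt _ u270) _.
    have -> : 4 * Num.sqrt u = 2 * (2 * Num.sqrt u) by ring.
    apply: ler_wpM2l => //; have -> : 2 = Num.sqrt (2 ^+ 2) :> R by rewrite sqrtr_sqr ger0_norm.
    rewrite -sqrtrM ?sqr_ge0//; apply: ler_wsqrtr; rewrite expr2.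
    by move: u27; clear; lra.
  have ks : k <= Num.sqrt u by rewrite -(ger0_norm k0) -sqrtr_sqr; exact: ler_wsqrtr.
  have -> : e%:R * (4 * Num.sqrt u) = eps / 2 * (k * Num.sqrt u).
    by rewrite /k; field; rewrite gt_eqF.
  apply: ler_wpM2l; first by rewrite divr_ge0// ltW.
  apply: (@le_trans _ _ (Num.sqrt u * Num.sqrt u)).
    by apply: ler_wpM2r => //; exact: sqrtr_ge0.
  by rewrite -expr2 sqr_sqrtr// ltW.
have q1 : `|ln c| <= eps * u by rewrite mulrC -ler_pdivrMr.
have q2 : 2 * `|ln C| <= eps * u by rewrite [leRHS]mulrC -ler_pdivrMr.
have -> : - a - ln (f rho) / u = - ((ln (f rho) + a * u) / u).
  by field; rewrite gt_eqF.
rewrite normrN normrM (@gtr0_norm _ u^-1) ?invr_gt0// ler_pdivrMr//.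
have r1 := ler_norm (- ln c); have r2 := ler_norm (ln C); rewrite normrN in r1.
rewrite ler_norml; apply/andP; split.
  by move: ln1 q1 r1; clear; lra.
by move: ln2 ln3 q2 r2; clear; lra.
Unshelve. all: by end_near.
Qed.

(** The argument common to both detectors: the error event lies inside the misled event and contains
    the failure event. *)
Lemma error_exponent {d} {T : measurableType d} {R : realType} (P : probability T R)
    (n m : nat) (sigma : R) (H : T -> 'M[R]_(n, m.+1)) (v : R -> T -> 'cV[R]_n)
    (s : T -> 'cV[R]_m.+1) (X : R -> set T) :
  sigma != 0 -> (m < n)%N ->
  (forall rho, 0 < rho -> model_law P sigma (Num.sqrt rho^-1) H (v rho) s) ->
  (forall rho, 0 < rho -> measurable (X rho)) ->
  (forall rho x, 0 < rho -> X rho x -> pm1vec (s x) -> misled (H x) (v rho x) (s x)) ->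
  (forall rho x, 0 < rho -> (forall z : 'cV[R]_m.+1, (forall j, `|z j 0| <= 1) ->
      sqnorm (H x *m s x + v rho x - H x *m z)
        <= sqnorm (H x *m s x + v rho x - H x *m flip_first m) -> z ord0 0 < 0) ->
    s x = const_mx 1 -> X rho x) ->
  ln (fine (P (X rho))) / ln rho @[rho --> +oo] --> (- (n%:R / 2) : R).
Proof.
move=> sigma0 mn law mX XM XL.
have [c c0 cP] := lost_prob_ge P n m sigma H s sigma0 mn.
have [C [u0 [e [C0 CP]]]] := misled_asymptotics P n m sigma H s sigma0 mn.
(* The maximum with [0] forces [ln rho >= 0], so that the noise deviation is at most [1]. *)
apply: (@ln_rate_cvg R _ _ c C (Num.max u0 0) e) => // rho rho0.
rewrite ge_max => /andP[u0u u_ge0].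
have PE : P (X rho) = (fine (P (X rho)))%:E by rewrite fineK// fin_num_measure//; exact: mX.
have wE : Num.sqrt rho^-1 = expR (- (ln rho / 2)).
  have -> : rho^-1 = expR (- (ln rho / 2)) ^+ 2.
    by rewrite -expRM_natl -{1}(lnK (rho0 : rho \is Num.pos)) -expRN; congr expR; field.
  by rewrite sqrtr_sqr ger0_norm ?expR_ge0.
have law' : model_law P sigma (expR (- (ln rho / 2))) H (v rho) s by rewrite -wE; exact: law.
have aE : n%:R / 2 * ln rho = n%:R * (ln rho / 2) by field.
rewrite -!lee_fin -PE aE; apply/andP; split.
  have := cP _ _ _ (expR_gt0 _) _ law' (mX _ rho0) (fun x => XL rho x rho0).
  rewrite -expRM_natl mulrN; apply.
  by rewrite expR_le1 oppr_le0 divr_ge0.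
exact: CP _ _ _ u0u law' (mX _ rho0) (fun x => XM rho x rho0).
Qed.

Theorem theorem1 (d : measure_display) (T : measurableType d) (R : realType)
  (P : probability T R) (n m : nat) (sigma : R)
  (H : T -> 'M[R]_(n, m)) (v : R -> T -> 'cV[R]_n) (s : T -> 'cV[R]_m)
  (ML : 'M[R]_(n, m) -> 'cV[R]_n -> 'cV[R]_m)
  (Xopt : 'M[R]_(n, m) -> 'cV[R]_n -> 'M[R]_(m + 1)) :
  (1 <= m)%N -> (m <= n)%N -> sigma != 0 ->
  (forall rho, 0 < rho -> model_law P sigma (Num.sqrt rho^-1) H (v rho) s) ->
  (forall Hm y, is_ML_point Hm y (ML Hm y)) ->
  (forall Hm y, is_SDR_opt Hm y (Xopt Hm y)) ->
  (forall rho, 0 < rho ->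
     measurable [set x | ML (H x) (H x *m s x + v rho x) != s x]) ->
  (forall rho, 0 < rho ->
     measurable [set x | sdr_decision (Xopt (H x) (H x *m s x + v rho x)) != s x]) ->
  (ln (fine (P [set x | sdr_decision (Xopt (H x) (H x *m s x + v rho x)) != s x]))
     / ln rho @[rho --> +oo] --> (- (n%:R / 2) : R)) /\
  (ln (fine (P [set x | ML (H x) (H x *m s x + v rho x) != s x]))
     / ln rho @[rho --> +oo] --> (- (n%:R / 2) : R)).
Proof.
case: m H s ML Xopt => // m H s ML Xopt _ mn sigma0 law MLP SDRP mML mSDR.
split; apply: (@error_exponent d T R P n m sigma H v s) => //.
- by move=> rho x rho0 /= err ps; exact: SDR_misled (SDRP _ _) err.
- move=> rho x rho0 h sx /=; set y := H x *m s x + v rho x in h *.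
  have [feas opt] := SDRP (H x) y.
  (* The last column of the optimal point fits at least as well as [flip_first], by optimality
     against the rank-one point of the latter. *)
  have z0 : (\col_i Xopt (H x) y (lshift 1 i) (rshift m.+1 ord0)) ord0 0 < 0.
    apply: h => [j|]; first by rewrite mxE feasible_le1.
    apply: le_trans (sqnorm_le_mxtrace _ _ _ feas) _.
    by apply: le_trans (opt _ (rank1_feasible _ (flip_first_pm1 m))) _; rewrite mxtrace_rank1.
  move: z0; rewrite mxE => z0; apply/eqP => /matrixP/(_ ord0 0).
  by rewrite sx !mxE /sgn ltNge (ltW z0)/= => ?; lra.
- by move=> rho x rho0 /= err ps; exact: ML_misled (MLP _ _) err.
- move=> rho x rho0 h sx /=; set y := H x *m s x + v rho x in h *.
  have [pt opt] := MLP (H x) y.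
  have z0 : ML (H x) y ord0 0 < 0.
    apply: h => [j|]; last exact: opt (flip_first_pm1 m).
    by case: (pt j) => ->; rewrite ?normrN normr1.
  by apply/eqP => eML; move: z0; rewrite eML sx mxE; lra.
Qed.
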